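(* Let $S$ be a closed symmetric linear relation in a Krein space $\mathfrak H$ with equal defect numbers $d\in\mathbb N$, and let $\mathsf b:S^*\to\mathbb C^{2d}$ be a boundary mapping for $S$ with Gram matrix $\mathsf Q$. Let $\mathcal P(z)\in\mathbb P_{\mathsf Q}$ and $\widetilde A\in\mathbb A_{S,\mathsf b}$, with $\widetilde A$ acting in $\widetilde{\mathfrak H}=\mathfrak H\oplus\widehat{\mathfrak H}$, and write $\operatorname{BEP}=\operatorname{BEP}(S,\mathsf b,\mathcal P(z))$. If $T_{\widetilde A}(z)=T_{S,\mathsf b,\mathcal P}(z)$ for all $z\in\mathbb C$, then the following statements hold. (I) $\sigma_{\mathrm p}(\operatorname{BEP})=\sigma_{\mathrm p}(\widetilde A)$. (II) Let $\lambda\in\overline{\mathbb C}$. There is a bijection between the Jordan chains $f_0,f_1,\dots,f_n\in\mathfrak H$ of the BEP at $\lambda$ and the Jordan chains $\widetilde f_0,\widetilde f_1,\dots,\widetilde f_n\in\widetilde{\mathfrak H}$ of $\widetilde A$ at $\lambda$. In particular, corresponding Jordan chains have the same maximal lengths. The bijection between the Jordan chains is given by the orthogonal projection $\widetilde P_{\mathfrak H}$ in $\widetilde{\mathfrak H}$ onto $\mathfrak H$ (that is, $f_k=\widetilde P_{\mathfrak H}\widetilde f_k$). If, in addition, $\sigma_{\mathrm p}(\widetilde A)=\sigma_{\mathrm p}(\widetilde A)^*$, then the BEP and $\widetilde A$ are spectrally equivalent; in detail: (III) (i) $\rho(\operatorname{BEP})=\rho(\widetilde A)$. (ii) If $\lambda\in\rho(\operatorname{BEP})$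 and $h\in\mathfrak H$, the solution $f\in\mathfrak H$ of the boundary eigenvalue problem at $\lambda$ is given by $$f=\widetilde P_{\mathfrak H}(\widetilde A-\lambda I_{\widetilde{\mathfrak H}})^{-1}\begin{bmatrix}h\\0\end{bmatrix}\ \text{ if }\lambda\in\mathbb C,\qquad f=\widetilde P_{\mathfrak H}\widetilde A\begin{bmatrix}h\\0\end{bmatrix}\ \text{ if }\lambda=\infty .$$ (IV) $\sigma_{\mathrm c}(\operatorname{BEP})=\sigma_{\mathrm c}(\widetilde A)$. (V) $\overline{\mathbb C}=\rho(\operatorname{BEP})\cup\sigma_{\mathrm c}(\operatorname{BEP})\cup\sigma_{\mathrm p}(\operatorname{BEP})$ (disjoint union), that is, $\sigma_{\mathrm r}(\operatorname{BEP})=\emptyset$.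
   Context: $\overline{\mathbb C}=\mathbb C\cup\{\infty\}$; $z^*$ is the complex conjugate of $z$, $\infty^*=\infty$, and $\Omega^*=\{z^*:z\in\Omega\}$ for $\Omega\subseteq\overline{\mathbb C}$. Linear relations. A (closed) linear relation $R$ in a Krein space $\mathfrak K$ is a (closed) linear subspace of $\mathfrak K^2$, with elements written $\{f,g\}$; operators are identified with their graphs. $\operatorname{nul}R=\{f:\{f,0\}\in R\}$, $R^{-1}=\{\{g,f\}:\{f,g\}\in R\}$, $R-\lambda I=\{\{f,g-\lambda f\}:\{f,g\}\in R\}$, $R^*=\{\{h,k\}:[g,h]=[f,k]\text{ for all }\{f,g\}\in R\}$. $R$ is symmetric if $R\subseteq R^*$, self-adjoint if $R=R^*$. Products of relations are compositions. Spectrum of a closed relation $R$. For $\lambda\in\mathbb C$: $\lambda\in\rho(R)$ if $\operatorname{nul}(R-\lambda I)=\{0\}$ and $(R-\lambda I)^{-1}$ is a bounded operator on (all of) $\mathfrak K$; $\lambda\in\sigma_{\mathrm p}(R)$ if $\operatorname{nul}(R-\lambda I)\ne\{0\}$; $\lambda\in\sigma_{\mathrm c}(R)$ if $\operatorname{nul}(R-\lambda I)=\{0\}$, $\operatorname{ran}(R-\lambda I)$ is dense and $\ne\mathfrak K$; $\lambda\in\sigma_{\mathrm r}(R)$ if $\operatorname{nul}(R-\lambda I)=\{0\}$ and $\operatorname{ran}(R-\lambda I)$ is not dense. $\infty$ belongs to one of these sets for $R$ iff $0$ belongs to the corresponding set for $R^{-1}$. Jordan chains of $R$. $h_0,\dots,h_n\in\mathfrak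 K$ is a Jordan chain of $R$ at $\lambda\in\mathbb C$ if $h_0\ne0$ and, with $h_{-1}=0$, $\{h_k,\lambda h_k+h_{k-1}\}\in R$ for $k=0,\dots,n$; at $\lambda=\infty$ the condition is $\{h_{k-1},h_k\}\in R$ for $k=0,\dots,n$. It has maximal length $n+1$ if it cannot be extended to a longer Jordan chain $h_0,\dots,h_n,h_{n+1}$. Symmetric relation and boundary mapping. $S$ has equal defect numbers $d\in\mathbb N=\{1,2,\dots\}$ means that $\dim S^*/S=2d$ and the form $\mathrm i([f,k]-[g,h])$ on $S^*/S$ has $d$ positive and $d$ negative squares. A boundary mapping for $S$ is a linear surjection $\mathsf b:S^*\to\mathbb C^{2d}$ with kernel $S$; its Gram matrix is the invertible self-adjoint matrix $\mathsf Q$ with $\mathrm i([f,k]-[g,h])=\mathsf b(\{h,k\})^*\mathsf Q\,\mathsf b(\{f,g\})$ for all $\{f,g\},\{h,k\}\in S^*$. The class $\mathbb P_{\mathsf Q}$: all $d\times2d$ matrix polynomials $\mathcal P(z)$ with row degrees $\mu_j$ such that (a) $\mathcal P(z)\mathsf Q^{-1}\mathcal P(z^* )^*=0$ for all $z\in\mathbb C$; (b) $\operatorname{rank}\mathcal P(z)=d$ for all $z\in\mathbb C$; (c) $\operatorname{rank}\mathsf P_\infty=d$, where $\mathsf P_\infty=\lim_{z\to\infty}\operatorname{diag}(z^{-\mu_1},\dots,z^{-\mu_d})\mathcal P(z)$; (d) $\mu_1\ge\cdots\ge\mu_d\ge0$. The row-reversal of $\mathcal P(z)$ is the matrix polynomial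 $\mathcal R(z)=\operatorname{diag}(z^{\mu_1},\dots,z^{\mu_d})\mathcal P(1/z)$ for $z\ne0$, $\mathcal R(0)=\mathsf P_\infty$. $T_{S,\mathsf b,\mathcal P}(z)=\{\{f,g\}\in S^*:\mathcal P(z)\mathsf b(\{f,g\})=0\}$ for $z\in\mathbb C$, and $T_{S,\mathsf b,\mathcal P}(\infty)=\{\{f,g\}\in S^*:\mathsf P_\infty\mathsf b(\{f,g\})=0\}$. The BEP. For $\lambda\in\mathbb C$ and $h\in\mathfrak H$ a solution $f$ of the BEP at $\lambda$ is an $f\in\mathfrak H$ for which there is $g$ with $\{f,g\}\in S^*$, $g-\lambda f=h$, $\mathcal P(\lambda)\mathsf b(\{f,g\})=0$; for $\lambda=\infty$ it is an $f$ with $\{h,f\}\in S^*$, $\mathsf P_\infty\mathsf b(\{h,f\})=0$. For $\lambda\in\overline{\mathbb C}$, $\lambda$ belongs to $\rho(\operatorname{BEP})$, $\sigma_{\mathrm p}(\operatorname{BEP})$, $\sigma_{\mathrm c}(\operatorname{BEP})$, $\sigma_{\mathrm r}(\operatorname{BEP})$ iff $\lambda$ belongs to $\rho$, $\sigma_{\mathrm p}$, $\sigma_{\mathrm c}$, $\sigma_{\mathrm r}$ of $T_{S,\mathsf b,\mathcal P}(\lambda)$, respectively. Jordan chains of the BEP. $f_0,\dots,f_n\in\mathfrak H$ is a Jordan chain of the BEP at $\lambda\in\mathbb C$ if $f_0\ne0$ and, with $f_{-1}=0$, for all $k\in\{0,\dots,n\}$: $\{f_k,\lambda f_k+f_{k-1}\}\in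 S^*$ and $\sum_{j=0}^k\frac1{j!}\mathcal P^{(j)}(\lambda)\,\mathsf b(\{f_{k-j},\lambda f_{k-j}+f_{k-j-1}\})=0$. At $\lambda=\infty$ the conditions are $\{f_{k-1},f_k\}\in S^*$ and $\sum_{j=0}^k\frac1{j!}\mathcal R^{(j)}(0)\,\mathsf b(\{f_{k-j-1},f_{k-j}\})=0$. It has maximal length $n+1$ if it cannot be extended to a longer Jordan chain $f_0,\dots,f_n,f_{n+1}$. The class $\mathbb A_{S,\mathsf b}$: all self-adjoint relations $\widetilde A$ in a Krein space $\widetilde{\mathfrak H}$ such that (a) $\mathfrak H$ is a Krein subspace of $\widetilde{\mathfrak H}$, with orthogonal complement $\widehat{\mathfrak H}$; (b) $S\subseteq\widetilde A$; (c) $\dim\widehat{\mathfrak H}<\infty$; (d) $\widehat S=\widetilde A\cap\widehat{\mathfrak H}^2$ is an operator without eigenvalues. With $\widetilde P_{\mathfrak H}$ the orthogonal projection onto $\mathfrak H$, the Shtraus subspaces are $T_{\widetilde A}(z)=\{\{\widetilde P_{\mathfrak H}\widetilde f,\widetilde P_{\mathfrak H}\widetilde g\}:\{\widetilde f,\widetilde g\}\in\widetilde A,\ \widetilde g-z\widetilde f\in\mathfrak H\}$, $z\in\mathbb C$. Spectral equivalence of $\widetilde A$ and the BEP means: $\rho(\operatorname{BEP})=\rho(\widetilde A)$, $\sigma_{\mathrm c}(\operatorname{BEP})=\sigma_{\mathrm c}(\widetilde A)$, $\sigma_{\mathrm p}(\operatorname{BEP})=\sigma_{\mathrm p}(\widetilde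 A)$, $\sigma_{\mathrm r}(\operatorname{BEP})=\sigma_{\mathrm r}(\widetilde A)$, and for each eigenvalue $\lambda\in\overline{\mathbb C}$ the Jordan chains of the BEP at $\lambda$ correspond bijectively to those of $\widetilde A$ at $\lambda$. *)

(* Defs.v *)
From HB Require Import structures.
From mathcomp Require Import all_boot all_order all_algebra.
From mathcomp Require Import all_classical all_reals all_analysis.
From mathcomp Require Import complex.

Set Implicit Arguments.
Unset Strict Implicit.
Unset Printing Implicit Defensive.
Import Order.TTheory GRing.Theory Num.Theory.
Import numFieldNormedType.Exports.

Local Open Scope classical_set_scope.
Local Open Scope sesquilinear_scope.
Local Open Scope ring_scope.
Local Open Scope complex_scope.

(* The extended complex plane is [option R[i]], with [None] as the point at
   infinity. *)
Definition conj_set (R : realType) (Omega : set (option R[i])) :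
    set (option R[i]) :=
  [set omap (Num.conj : R[i] -> R[i]) z | z in Omega].

Section Subspaces.
Variables (R : realType) (V : lmodType R[i]).

Definition lin_subspace (U : set V) : Prop :=
  U 0 /\ forall (a : R[i]) x y, U x -> U y -> U (a *: x + y).

(* dim W / U = n: the classes of e_1, ..., e_n form a basis of W / U. *)
Definition dim_quot (W U : set V) (n : nat) : Prop :=
  exists e : 'I_n -> V,
    [/\ forall i, W (e i),
        forall x, W x -> exists c : 'I_n -> R[i], U (x - \sum_i c i *: e i)
      & forall c : 'I_n -> R[i], U (\sum_i c i *: e i) -> forall i, c i = 0].

Definition finite_dim (W : set V) : Prop := exists n, dim_quot W [set 0] n.

(* W contains n vectors spanning an n-dimensional space on which F is
   positive definite. *)
Definition has_pos_def (W : set V) (F : V -> V -> R[i]) (n : nat) : Prop :=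
  exists e : 'I_n -> V,
    (forall i, W (e i)) /\
    (forall c : 'I_n -> R[i], (exists i, c i != 0) ->
       0 < F (\sum_i c i *: e i) (\sum_i c i *: e i)).

(* The form F has exactly n positive squares on W: n is the largest dimension
   of a positive definite subspace.  Passing to the quotient of W by a subspace
   of the kernel of F does not change this number. *)
Definition pos_squares (W : set V) (F : V -> V -> R[i]) (n : nat) : Prop :=
  has_pos_def W F n /\ forall m, has_pos_def W F m -> (m <= n)%N.

Definition neg_squares (W : set V) (F : V -> V -> R[i]) (n : nat) : Prop :=
  pos_squares W (fun x y => - F x y) n.

End Subspaces.

Section Krein.
Variables (R : realType) (H : completeNormedModType R[i]).

Definition fundamental_symmetry (ip : {hermitian H for false & Num.conj})
    (J : {linear H -> H}) : Prop :=
  [/\ forall x, J (J x) = x,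
      forall x y, ip (J x) y = ip x (J y)
    & forall x, `|x| ^+ 2 = ip (J x) x].

(* A Krein space is a space with an inner product ip having a fundamental
   decomposition H = H+ [+] H-, where (H+, ip) and (H-, - ip) are Hilbert
   spaces; with J = 1 on H+ and J = -1 on H-, this says that the positive
   definite form ip (J x) y makes H a Hilbert space.  The norm of H is one of
   the resulting (pairwise equivalent) Hilbert norms, so that the topology of H
   is the topology of the Krein space; completeness is in the type of H. *)
Definition krein (ip : {hermitian H for false & Num.conj}) : Prop :=
  exists J : {linear H -> H}, fundamental_symmetry ip J.

End Krein.

Section KreinSubspace.
Variables (R : realType) (H Ht : completeNormedModType R[i]).
Variables (ip : {hermitian H for false & Num.conj}).
Variables (ipt : {hermitian Ht for false & Num.conj}).

Definition orth_compl (iota : H -> Ht) : set Ht :=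
  [set x | forall h, ipt x (iota h) = 0].

(* H, identified with its image under the isometry iota, is a Krein subspace of
   Ht: Ht is the orthogonal sum of H and its orthogonal complement. *)
Definition krein_subspace (iota : {linear H -> Ht}) : Prop :=
  isometry ipt ip iota /\ forall x, exists h, orth_compl iota (x - iota h).

(* The orthogonal projection of x onto H, as an element of H. *)
Definition orth_proj (iota : {linear H -> Ht}) (x : Ht) : H :=
  xget 0 [set h | orth_compl iota (x - iota h)].

End KreinSubspace.

Section Relations.
Variables (R : realType) (V : completeNormedModType R[i]).
Implicit Type A : set (V * V).

Definition rel_nul A : set V := [set f | A (f, 0)].

Definition rel_ran A : set V := [set g | exists f, A (f, g)].

Definition rel_inv A : set (V * V) := [set p | A (p.2, p.1)].

Definition rel_shift A (l : R[i]) : set (V * V) :=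
  [set (p.1, p.2 - l *: p.1) | p in A].

Definition is_operator A : Prop := forall g, A (0, g) -> g = 0.

(* The value of A at f; it is meaningful when A is an operator with f in its
   domain. *)
Definition rel_app A (f : V) : V := xget 0 [set g | A (f, g)].

Definition rel_adj (ip : V -> V -> R[i]) A : set (V * V) :=
  [set p | forall f g, A (f, g) -> ip g p.1 = ip f p.2].

Definition symmetric_rel ip A : Prop := lin_subspace A /\ A `<=` rel_adj ip A.

Definition selfadjoint_rel ip A : Prop := A = rel_adj ip A.

Definition everywhere_bounded_operator A : Prop :=
  exists T : {linear V -> V},
    (exists M : R[i], forall f, `|T f| <= M * `|f|) /\
    (forall f g, A (f, g) <-> g = T f).

Definition fin_res A (l : R[i]) : Prop :=
  rel_nul (rel_shift A l) = [set 0] /\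
  everywhere_bounded_operator (rel_inv (rel_shift A l)).

Definition fin_sp_p A (l : R[i]) : Prop := rel_nul (rel_shift A l) <> [set 0].

Definition fin_sp_c A (l : R[i]) : Prop :=
  [/\ rel_nul (rel_shift A l) = [set 0],
      dense (rel_ran (rel_shift A l))
    & rel_ran (rel_shift A l) <> setT].

Definition fin_sp_r A (l : R[i]) : Prop :=
  rel_nul (rel_shift A l) = [set 0] /\ ~ dense (rel_ran (rel_shift A l)).

(* infinity is in a set for A iff 0 is in the set for A^-1. *)
Definition extend (X : set (V * V) -> R[i] -> Prop) A : set (option R[i]) :=
  [set z | match z with Some l => X A l | None => X (rel_inv A) 0 end].

Definition res := extend fin_res.
Definition sp_p := extend fin_sp_p.
Definition sp_c := extend fin_sp_c.
Definition sp_r := extend fin_sp_r.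

(* For a sequence s = h_0, ..., h_n and h_{-1} = 0, this is the pair
   {h_k, l h_k + h_{k-1}}, resp. {h_{k-1}, h_k} at infinity. *)
Definition chain_pair (z : option R[i]) (s : seq V) (k : nat) : V * V :=
  match z with
  | Some l => (s`_k, l *: s`_k + (0 :: s)`_k)
  | None => ((0 :: s)`_k, s`_k)
  end.

Definition jordan_chain A (z : option R[i]) : set (seq V) :=
  [set s | [/\ s != [::], s`_0 != 0
             & forall k, (k < size s)%N -> A (chain_pair z s k)]].

(* s is a chain of maximal length, for chains in the set X. *)
Definition maximal_chain (X : set (seq V)) (s : seq V) : Prop :=
  X s /\ ~ exists h, X (rcons s h).

End Relations.

Section MatrixPolynomials.
Variables (R : realType) (m n : nat).
Implicit Type P : 'M[{poly R[i]}]_(m, n).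

Definition mxpoly_at P (z : R[i]) : 'M[R[i]]_(m, n) :=
  map_mx (fun p : {poly R[i]} => p.[z]) P.

Definition mxpoly_deriv P (j : nat) : 'M[{poly R[i]}]_(m, n) :=
  map_mx (derivn j) P.

Definition row_degree P (i : 'I_m) : nat := \max_j (size (P i j)).-1.

Definition row_reversal P : 'M[{poly R[i]}]_(m, n) :=
  \matrix_(i, j)
    \poly_(k < (row_degree P i).+1) (P i j)`_(row_degree P i - k).

(* The matrix P_infinity; see [mxpoly_inf_lim]. *)
Definition mxpoly_inf P : 'M[R[i]]_(m, n) := mxpoly_at (row_reversal P) 0.

Lemma row_reversalE P (z : R[i]) : z != 0 ->
  mxpoly_at (row_reversal P) z =
  diag_mx (\row_i z ^+ row_degree P i) *m mxpoly_at P z^-1.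
Proof.
move=> z0; apply/matrixP => i j; rewrite mul_diag_mx !mxE horner_poly.
rewrite (@horner_coef_wide _ (row_degree P i).+1); last first.
  by rewrite (leq_trans (leqSpred _))// ltnS /row_degree (leq_bigmax j).
rewrite big_distrr/= (reindex_inj rev_ord_inj)/=; apply: eq_bigr => k _.
have kd : (k <= row_degree P i)%N by rewrite -ltnS.
rewrite subSS subKn// mulrCA; congr (_ * _).
by rewrite exprVn -expfB_cond// (negPf z0).
Qed.

Lemma mxpoly_inf_lim P (eps : R[i]) : 0 < eps ->
  exists2 M : R[i], 0 < M & forall z : R[i], M < `|z| -> forall i j,
    `|(diag_mx (\row_i z ^- row_degree P i) *m mxpoly_at P z) i j
      - mxpoly_inf P i j| < eps.
Proof.
move=> eps0.
pose F i j := row_reversal P i j.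
pose B := \sum_i \sum_j \sum_(k < size (F i j)) `|(F i j)`_k|.
have Fle i j (w : R[i]) : `|w| <= 1 -> `|(F i j).[w] - (F i j).[0]| <= `|w| * B.
  move=> w1; have sub0 (x y : R[i]) : 0 <= y -> x <= x + y by rewrite lerDl.
  apply: (@le_trans _ _ (`|w| * \sum_(k < size (F i j)) `|(F i j)`_k|)).
    rewrite !horner_coef -sumrB mulr_sumr (le_trans (ler_norm_sum _ _ _))//.
    apply: ler_sum => k _; rewrite -mulrBr normrM mulrC ler_wpM2r//.
    case: k => -[|k]/= _; first by rewrite !expr0 subrr normr0.
    by rewrite expr0n subr0 normrX exprS ler_piMr// exprn_ile1.
  rewrite ler_wpM2l// /B (bigD1 i)//= (bigD1 j)//= -addrA sub0// addr_ge0//.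
    by do 2!apply: sumr_ge0 => ? _.
  by do 3!apply: sumr_ge0 => ? _.
have B0 : 0 <= B by do 3!apply: sumr_ge0 => ? _.
exists (1 + B / eps); first by rewrite ltr_wpDr// divr_ge0// ltW.
move=> z zM i j.
have z1 : 1 < `|z| by rewrite (le_lt_trans _ zM)// lerDl divr_ge0// ltW.
have zgt0 : 0 < `|z| by exact: lt_trans z1.
have z0 : z != 0 by rewrite -normr_gt0.
have zv0 : z^-1 != 0 by rewrite invr_eq0.
have <- : mxpoly_at (row_reversal P) z^-1 i j =
    (diag_mx (\row_i z ^- row_degree P i) *m mxpoly_at P z) i j.
  rewrite (row_reversalE P zv0) invrK; congr ((diag_mx _ *m _) _ _).
  by apply/rowP => k; rewrite !mxE exprVn.
rewrite /mxpoly_inf /mxpoly_at [X in `|X - _|]mxE [X in `|_ - X|]mxE.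
apply: (le_lt_trans (Fle i j _ _)); rewrite normfV.
  by rewrite invf_le1// ltW.
rewrite mulrC ltr_pdivrMr// -ltr_pdivrMl// mulrC.
by rewrite (le_lt_trans _ zM)// lerDr.
Qed.

(* The value of P at a point of the extended plane, and the matrix polynomial
   whose Taylor coefficients at the center enter the Jordan chains there. *)
Definition mxpoly_ext P (z : option R[i]) : 'M[R[i]]_(m, n) :=
  if z is Some l then mxpoly_at P l else mxpoly_inf P.

Definition mxpoly_taylor P (z : option R[i]) (j : nat) : 'M[R[i]]_(m, n) :=
  (j`!%:R)^-1 *:
    match z with
    | Some l => mxpoly_at (mxpoly_deriv P j) l
    | None => mxpoly_at (mxpoly_deriv (row_reversal P) j) 0
    end.

End MatrixPolynomials.

Definition class_P (R : realType) (d : nat) (Q : 'M[R[i]]_(2 * d))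
    (P : 'M[{poly R[i]}]_(d, 2 * d)) : Prop :=
  [/\ forall z : R[i],
        mxpoly_at P z *m invmx Q *m (mxpoly_at P (Num.conj z)) ^t* = 0,
      forall z : R[i], \rank (mxpoly_at P z) = d,
      \rank (mxpoly_inf P) = d
    & forall i j : 'I_d, (i <= j)%N -> (row_degree P j <= row_degree P i)%N].

Section BEP.
Variables (R : realType) (H : completeNormedModType R[i]).
Variables (ip : {hermitian H for false & Num.conj}) (S : set (H * H)) (d : nat).

(* i ([f, k] - [g, h]) for p = {f, g} and q = {h, k}. *)
Definition boundary_form (p q : H * H) : R[i] :=
  'i%C * (ip p.1 q.2 - ip p.2 q.1).

Definition equal_defect : Prop :=
  [/\ dim_quot (rel_adj ip S) S (2 * d),
      pos_squares (rel_adj ip S) boundary_form d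
    & neg_squares (rel_adj ip S) boundary_form d].

(* b is a function on all pairs, of which only the restriction to S^* is used. *)
Definition boundary_mapping (b : H * H -> 'cV[R[i]]_(2 * d)) : Prop :=
  [/\ forall (a : R[i]) p q, rel_adj ip S p -> rel_adj ip S q ->
        b (a *: p + q) = a *: b p + b q,
      forall v, exists2 p, rel_adj ip S p & b p = v
    & forall p, rel_adj ip S p -> (b p = 0 <-> S p)].

Definition gram_matrix (b : H * H -> 'cV[R[i]]_(2 * d))
    (Q : 'M[R[i]]_(2 * d)) : Prop :=
  [/\ Q \in unitmx, Q ^t* = Q
    & forall p q, rel_adj ip S p -> rel_adj ip S q ->
        boundary_form p q = ((b q) ^t* *m Q *m b p) 0 0].

Variables (b : H * H -> 'cV[R[i]]_(2 * d)) (P : 'M[{poly R[i]}]_(d, 2 * d)).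

Definition bep_rel (z : option R[i]) : set (H * H) :=
  [set p | rel_adj ip S p /\ mxpoly_ext P z *m b p = 0].

Definition bep_solution (z : option R[i]) (h : H) : set H :=
  [set f | match z with
    | Some l => exists g, [/\ rel_adj ip S (f, g), g - l *: f = h
                            & mxpoly_at P l *m b (f, g) = 0]
    | None => rel_adj ip S (h, f) /\ mxpoly_inf P *m b (h, f) = 0
    end].

Definition bep_res : set (option R[i]) := [set z | res (bep_rel z) z].
Definition bep_sp_p : set (option R[i]) := [set z | sp_p (bep_rel z) z].
Definition bep_sp_c : set (option R[i]) := [set z | sp_c (bep_rel z) z].
Definition bep_sp_r : set (option R[i]) := [set z | sp_r (bep_rel z) z].

Definition bep_jordan_chain (z : option R[i]) : set (seq H) :=
  [set s | [/\ s != [::], s`_0 != 0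
    & forall k, (k < size s)%N ->
        rel_adj ip S (chain_pair z s k) /\
        \sum_(j < k.+1) mxpoly_taylor P z j *m b (chain_pair z s (k - j)) = 0]].

End BEP.

Section Exit.
Variables (R : realType) (H Ht : completeNormedModType R[i]).
Variables (ip : {hermitian H for false & Num.conj}).
Variables (ipt : {hermitian Ht for false & Num.conj}).
Variable (iota : {linear H -> Ht}).

(* The class A_{S,b}; H is a Krein subspace of Ht via iota. *)
Definition class_A (S : set (H * H)) (A : set (Ht * Ht)) : Prop :=
  let Hhat := orth_compl ipt iota in
  let Shat := A `&` (Hhat `*` Hhat) in
  [/\ selfadjoint_rel ipt A,
      krein_subspace ip ipt iota,
      forall f g, S (f, g) -> A (iota f, iota g),
      finite_dim Hhat
    & is_operator Shat /\
      forall l : R[i], rel_nul (rel_shift Shat l) = [set 0]].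

Definition shtraus (A : set (Ht * Ht)) (z : R[i]) : set (H * H) :=
  [set (orth_proj ipt iota p.1, orth_proj ipt iota p.2)
    | p in [set p | A p /\ range iota (p.2 - z *: p.1)]].

Definition spectrally_equivalent (S : set (H * H)) (d : nat)
    (b : H * H -> 'cV[R[i]]_(2 * d)) (P : 'M[{poly R[i]}]_(d, 2 * d))
    (A : set (Ht * Ht)) : Prop :=
  [/\ bep_res ip S b P = res A,
      bep_sp_c ip S b P = sp_c A,
      bep_sp_p ip S b P = sp_p A,
      bep_sp_r ip S b P = sp_r A
    & forall z, sp_p A z ->
        exists phi : seq Ht -> seq H,
          set_bij (jordan_chain A z) (bep_jordan_chain ip S b P z) phi /\
          forall s, jordan_chain A z s -> size (phi s) = size s].

End Exit.

(* Main.v *)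
(* Choose a basis e_i of the finite dimensional complement of H and describe the
   component of x there by the column of the pairings [x, e_i].  In a coordinate w
   of the extended plane vanishing at z, the pencil of the pairs p in A becomes
   beta - w alpha, where alpha and beta are the components of the "domain" and
   "range" entries of p relative to z; Jordan chains of A at z are the solutions
   of the recursion beta x_0 = 0, beta x_(k+1) = alpha x_k.
   Self-adjointness and the absence of eigenvalues of the part of A in the
   complement make beta surjective at every z, infinity included.  Hence a chain
   extends to a solution of beta y = w alpha y that is polynomial in w, along which
   P(w) b(y) = 0 as a polynomial identity; its Taylor coefficients are the boundary
   conditions for chains.  Conversely, ker P(z) = b(ker beta) lets one lift chains
   one vector at a time; at infinity this equality follows from its inclusion by
   counting dimensions.
   For the other parts of the spectrum, a vector orthogonal to the range of the
   boundary problem at z extends to one orthogonal to the range of A - z, that is, to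
   an eigenvector of A at z^*.  So there is no residual spectrum on either side when
   the point spectrum is symmetric, and the two ranges are full simultaneously.  A
   full range gives a bounded inverse because the inverse has a densely defined
   adjoint (Hellinger-Toeplitz). *)

Require Import Defs.
From HB Require Import structures.
From mathcomp Require Import all_boot all_order all_algebra.
From mathcomp Require Import all_classical all_reals all_analysis.
From mathcomp Require Import complex.
From mathcomp Require Import ring lra.
Set Implicit Arguments.
Unset Strict Implicit.
Unset Printing Implicit Defensive.
Import Order.TTheory GRing.Theory Num.Theory.
Import numFieldNormedType.Exports.

Local Open Scope classical_set_scope.
Local Open Scope ring_scope.
Local Open Scope complex_scope.

(** * Norms as real numbers, and limits of sequences *)

Section RealNorm.
Variables (R : realType) (V : normedZmodType R[i]).
Implicit Types x y : V.

(** Norms take values in [R[i]]; the real version makes the total order of [R] available for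
    estimates. *)
Definition rnorm x : R := complex.Re `|x|.

Lemma rnormE x : `|x| = (rnorm x)%:C.
Proof. by rewrite /rnorm RRe_real. Qed.

Lemma rnorm_ge0 x : 0 <= rnorm x.
Proof. by rewrite -lecR -rnormE normr_ge0. Qed.

Lemma rnorm_eq0 x : rnorm x = 0 -> x = 0.
Proof. by move=> x0; apply/normr0_eq0; rewrite rnormE x0. Qed.

Lemma rnormD x y : rnorm (x + y) <= rnorm x + rnorm y.
Proof. by rewrite -lecR rmorphD/= -!rnormE ler_normD. Qed.

Lemma rnormN x : rnorm (- x) = rnorm x.
Proof. by rewrite /rnorm normrN. Qed.

Lemma rnormB x y : rnorm (x - y) = rnorm (y - x).
Proof. by rewrite /rnorm distrC. Qed.

Lemma rnorm_dist x y z : rnorm (x - z) <= rnorm (x - y) + rnorm (y - z).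
Proof. by have := rnormD (x - y) (y - z); rewrite addrA subrK. Qed.

End RealNorm.

Section RealNormMod.
Variables (R : realType) (V : normedModType R[i]).
Implicit Types x y : V.

Lemma rnormZ (a : R[i]) x : rnorm (a *: x) = rnorm a * rnorm x.
Proof.
by apply: (@complexI R); rewrite rmorphM/= -!rnormE normrZ.
Qed.

End RealNormMod.

Lemma rnormM (R : realType) (a b : R[i]) : rnorm (a * b) = rnorm a * rnorm b.
Proof. by apply: (@complexI R); rewrite rmorphM/= -!rnormE normrM. Qed.

Lemma rnormR (R : realType) (a : R) : rnorm a%:C = `|a|.
Proof. by apply: (@complexI R); rewrite -rnormE normc_def /= expr0n /= addr0 sqrtr_sqr. Qed.

Lemma conjC_real (R : realType) (a : R) : Num.conj (a%:C : R[i]) = a%:C.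
Proof. exact: conjc_real. Qed.

Section RealComplex.
Variables (R : realType).
Implicit Types a b : R.

Lemma realCD a b : (a + b)%:C = a%:C + b%:C :> R[i].
Proof. exact: rmorphD. Qed.

Lemma realCB a b : (a - b)%:C = a%:C - b%:C :> R[i].
Proof. exact: rmorphB. Qed.

Lemma realCM a b : (a * b)%:C = a%:C * b%:C :> R[i].
Proof. exact: rmorphM. Qed.

Lemma realC_nat n : (n%:R)%:C = n%:R :> R[i].
Proof. exact: rmorph_nat. Qed.

End RealComplex.

Section Limits.
Variables (R : realType).

Lemma exp3V_small (e : R) : 0 < e -> exists N, forall n, (N <= n)%N -> 3 ^- n < e.
Proof.
move=> e0; exists (Num.truncn e^-1).+1 => n Nn.
have n3 : (n%:R : R) <= 3 ^+ n.
  elim: n {Nn} => [|n ih]; first by rewrite expr0 ler01.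
  have : (1 : R) <= 3 ^+ n by rewrite exprn_ege1// ler1n.
  by rewrite exprS -[n.+1%:R]natr1; lra.
rewrite invf_plt ?posrE ?exprn_gt0//.
apply: lt_le_trans n3; apply: lt_le_trans (truncnS_gt _) _.
by rewrite ler_nat.
Qed.

Lemma cauchy_rnorm (V : completeNormedModType R[i]) (u : nat -> V) :
  (forall e : R, 0 < e -> exists N, forall m n, (N <= m)%N -> (N <= n)%N ->
     rnorm (u m - u n) < e) ->
  exists l, forall e : R, 0 < e -> exists N, forall n, (N <= n)%N ->
     rnorm (l - u n) < e.
Proof.
move=> uC.
have pos (e : R[i]) : 0 < e -> 0 < complex.Re e /\ e = (complex.Re e)%:C.
  move=> e0; have eE : e = (complex.Re e)%:C by rewrite RRe_real// gtr0_real.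
  by split=> //; rewrite -ltcR -eE.
have cv : cvg (u @ \oo).
  apply/cauchy_cvgP/cauchy_ballP => e /pos[e0 eE].
  have [N uN] := uC _ e0.
  rewrite near_map2; exists ([set n | (N <= n)%N], [set n | (N <= n)%N]) => /=.
    by split; exists N.
  case=> m n /= [Nm Nn]; rewrite -ball_normE/= eE rnormE ltcR; exact: uN.
exists (lim (u @ \oo)) => e e0.
have /cvgrPdist_lt/(_ e%:C) := cv; rewrite ltcR => /(_ e0) [N _ uN].
by exists N => n Nn; have := uN n Nn; rewrite rnormE ltcR.
Qed.

End Limits.

(** * Krein space geometry: orthogonality and uniform boundedness *)

Section KreinSpace.
Variables (R : realType) (H : completeNormedModType R[i]).
Variables (ip : {hermitian H for false & Num.conj}).

Lemma ipC x y : ip x y = Num.conj (ip y x).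
Proof. by rewrite hermC expr0 mul1r. Qed.

Lemma ipZr a x y : ip x (a *: y) = Num.conj a * ip x y.
Proof. by rewrite linearZr_LR. Qed.

Lemma ipZl a x y : ip (a *: x) y = a * ip x y.
Proof. by rewrite linearZl_LR. Qed.

Lemma ipDl x y z : ip (x + y) z = ip x z + ip y z.
Proof. by rewrite linearDl. Qed.

Lemma ipDr x y z : ip x (y + z) = ip x y + ip x z.
Proof. by rewrite linearDr. Qed.

Lemma ipBl x y z : ip (x - y) z = ip x z - ip y z.
Proof. by rewrite linearBl. Qed.

Lemma ipBr x y z : ip x (y - z) = ip x y - ip x z.
Proof. by rewrite linearBr. Qed.

Lemma ip_sumr x n (c : 'I_n -> R[i]) (e : 'I_n -> H) :
  ip x (\sum_i c i *: e i) = \sum_i Num.conj (c i) * ip x (e i).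
Proof. by rewrite linear_sumr; apply: eq_bigr => i _; exact: ipZr. Qed.

Variable J : {linear H -> H}.
Hypothesis JP : fundamental_symmetry ip J.

Lemma fsymK x : J (J x) = x. Proof. by have [+ _ _] := JP; apply. Qed.

Lemma fsym_adj x y : ip (J x) y = ip x (J y).
Proof. by have [_ + _] := JP; apply. Qed.

Lemma fsym_norm x : `|x| ^+ 2 = ip (J x) x.
Proof. by have [_ _ +] := JP; apply. Qed.

Lemma fsym_rnorm x : ip (J x) x = (rnorm x ^+ 2)%:C.
Proof. by rewrite -fsym_norm rnormE rmorphXn. Qed.

Lemma rnorm_fsym x : rnorm (J x) = rnorm x.
Proof.
apply/eqP; rewrite -(@eqrXn2 _ 2) ?rnorm_ge0//; apply/eqP.
apply: (@complexI R).
by rewrite -!fsym_rnorm fsymK ipC fsym_rnorm conjC_real.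
Qed.

Lemma krein_nondeg x : (forall y, ip x y = 0) -> x = 0.
Proof.
move=> x0; apply/rnorm_eq0/eqP; rewrite -sqrf_eq0.
by rewrite -(inj_eq (@complexI R)) -fsym_rnorm fsym_adj x0.
Qed.

(** [J] is isometric, so replacing [x] by [J x] reduces the claim to the Hilbert inner product
    [ip (J x) y]. *)
Lemma krein_CauchySchwarz x y : rnorm (ip x y) <= rnorm x * rnorm y.
Proof.
rewrite -(rnorm_fsym x); set x' := J x.
have -> : ip x y = ip (J x') y by rewrite fsymK.
move: {x} x' => x.
have [y0|y0] := eqVneq (rnorm y) 0.
  by rewrite (rnorm_eq0 y0) linear0r /rnorm !normr0 mulr0.
set c := ip (J x) y.
have ny : (rnorm y ^+ 2)%:C != 0 :> R[i].
  by rewrite (inj_eq (@complexI R)) expf_eq0.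
(* [t *: y] is the Hilbert space projection of [x] onto the line through [y]. *)
pose t := c / (rnorm y ^+ 2)%:C.
have := fsym_rnorm (x - t *: y).
rewrite [J _]linearB [J (t *: y)]linearZ ipBl !ipBr !ipZl !ipZr !fsym_rnorm -/c.
have -> : ip (J y) x = Num.conj c by rewrite fsym_adj ipC.
have cc : c * Num.conj c = (rnorm c ^+ 2)%:C by rewrite -normCK rnormE rmorphXn.
have tE : Num.conj t = Num.conj c / (rnorm y ^+ 2)%:C.
  rewrite /t rmorphM fmorphV; congr (_ / _); exact: conjC_real.
have -> : (rnorm x ^+ 2)%:C - Num.conj t * c - (t * Num.conj c - t * (Num.conj t * (rnorm y ^+ 2)%:C))
   = (rnorm x ^+ 2 - rnorm c ^+ 2 / rnorm y ^+ 2)%:C.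
  have -> : (rnorm x ^+ 2 - rnorm c ^+ 2 / rnorm y ^+ 2)%:C =
      (rnorm x ^+ 2)%:C - c * Num.conj c / (rnorm y ^+ 2)%:C.
    by rewrite cc rmorphB fmorph_div.
  by rewrite tE /t; field; rewrite fmorph_eq0.
move=> /complexI xtE.
have := sqr_ge0 (rnorm (x - t *: y)); rewrite -xtE subr_ge0.
rewrite ler_pdivrMr ?exprn_gt0 ?lt_def ?y0 ?rnorm_ge0// -exprMn.
by rewrite ler_pXn2r ?nnegrE ?mulr_ge0 ?rnorm_ge0.
Qed.

Lemma fsym_parallelogram (x y : H) :
  rnorm (x - y) ^+ 2 = 2 * rnorm x ^+ 2 + 2 * rnorm y ^+ 2 - rnorm (x + y) ^+ 2.
Proof.
apply: (@complexI R).
rewrite realCB realCD 2![in RHS]realCM realC_nat -!fsym_rnorm.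
rewrite [J (x - y)]linearB [J (x + y)]linearD.
rewrite !(ipBl, ipBr, ipDl, ipDr); ring.
Qed.

(* If [ip (J y) u != 0], subtracting a small multiple of u shortens y. *)
Lemma minimal_orth (y u : H) :
  (forall t : R[i], rnorm y <= rnorm (y - t *: u)) -> ip (J y) u = 0.
Proof.
move=> ymin; set c := ip (J y) u.
have cc : c * Num.conj c = (rnorm c ^+ 2)%:C by rewrite -normCK rnormE rmorphXn.
(* Then [tau * |u|^2 = 1 - tau], and subtracting [(tau * c) *: u] lowers [|y|^2] by
   [tau * (1 + tau) * |c|^2]. *)
pose tau : R := (1 + rnorm u ^+ 2)^-1.
have u0 := sqr_ge0 (rnorm u).
have tau0 : 0 < tau by rewrite invr_gt0; lra.
have tauE : tau * rnorm u ^+ 2 = 1 - tau by rewrite /tau; field; apply: lt0r_neq0; lra.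
have := fsym_rnorm (y - (tau%:C * c) *: u).
rewrite [J _]linearB [J (_ *: u)]linearZ ipBl !ipBr !ipZl !ipZr !fsym_rnorm -/c.
have -> : ip (J u) y = Num.conj c by rewrite fsym_adj ipC.
have -> : Num.conj (tau%:C * c) = tau%:C * Num.conj c.
  by rewrite [LHS]rmorphM; congr (_ * _); exact: conjC_real.
have -> : (rnorm y ^+ 2)%:C - tau%:C * Num.conj c * c - (tau%:C * c * Num.conj c
    - tau%:C * c * (tau%:C * Num.conj c * (rnorm u ^+ 2)%:C))
   = (rnorm y ^+ 2 - tau * rnorm c ^+ 2 * (2 - tau * rnorm u ^+ 2))%:C.
  rewrite realCB realCM [(tau * rnorm c ^+ 2)%:C]realCM -cc.
  by rewrite realCB realCM realC_nat; ring.
move=> /complexI; rewrite tauE => E.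
have := ymin (tau%:C * c).
rewrite -(@ler_pXn2r _ 2) ?nnegrE ?rnorm_ge0// -E => le.
have : rnorm c ^+ 2 <= 0.
  rewrite leNgt; apply/negP => c0.
  have t1 : 0 < 1 + tau by lra.
  have := mulr_gt0 (mulr_gt0 tau0 c0) t1.
  by lra.
move=> c0; apply: rnorm_eq0; apply/eqP.
by rewrite -sqrf_eq0 eq_le c0 sqr_ge0.
Qed.

(** A point [x0] has positive distance from [U]. A minimizing sequence in [x0 + U] is Cauchy by the
    parallelogram law; its limit [l] is Hilbert-orthogonal to [U], so [J l] is orthogonal for
    [ip]. *)
Lemma exists_orthogonal (U : set H) :
  lin_subspace U -> ~ dense U -> exists2 x, x != 0 & forall u, U u -> ip u x = 0.
Proof.
move=> [U0 Ulin] /existsNP[G /not_implyP].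
move=> [[x0 Gx0]] /not_implyP[oG UG].
have [e e0 eU] : exists2 e : R, 0 < e & forall u, U u -> e <= rnorm (x0 - u).
  have /nbhs_ballP[e /= e0 xeG] := open_nbhs_nbhs (conj oG Gx0).
  exists (complex.Re e); first by rewrite -ltcR RRe_real// gtr0_real.
  move=> u Uu; rewrite leNgt; apply/negP => ux; apply: UG; exists u; split=> //.
  by apply: xeG; rewrite -ball_normE/= rnormE -[e]RRe_real ?gtr0_real// ltcR.
pose E := [set rnorm (x0 - u) | u in U].
have Einf : has_inf E.
  split; first by exists (rnorm (x0 - 0)), 0.
  by exists 0 => _ [u _ <-]; exact: rnorm_ge0.
have d0 : 0 <= inf E.
  by apply: lb_le_inf; [case: Einf|move=> _ [u _ <-]; exact: rnorm_ge0].
have dle u : U u -> inf E <= rnorm (x0 - u).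
  by move=> Uu; apply: ge_inf; [case: Einf|exists u].
have ap n : exists y, U (x0 - y) /\ rnorm y < inf E + 3 ^- n.
  have s0 : 0 < 3 ^- n :> R by rewrite invr_gt0 exprn_gt0.
  have [_ [u Uu <-] lt] := inf_adherent s0 Einf.
  by exists (x0 - u); rewrite subKr.
have {ap} [y yP] := choice ap.
have yU n : U (x0 - y n) by case: (yP n).
have yd n : rnorm (y n) < inf E + 3 ^- n by case: (yP n).
have dU v : U (x0 - v) -> inf E <= rnorm v.
  by move=> /dle; rewrite subKr.
have [l lP] : exists l, forall eps : R, 0 < eps -> exists N, forall n, (N <= n)%N ->
     rnorm (l - y n) < eps.
  apply: cauchy_rnorm => eps eps0.
  (* The parallelogram law bounds [|y m - y n|^2] by [4 (inf E + eta)^2 - 4 (inf E)^2], which is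
     below [8 (inf E + 1) eta] since [eta <= 1]. *)
  pose eta := Num.min 1 (eps ^+ 2 / (8 * (inf E + 1))).
  have eta0 : 0 < eta.
    by rewrite lt_min ltr01 divr_gt0 ?exprn_gt0// mulr_gt0//; lra.
  have [N NP] := exp3V_small eta0.
  exists N => m n Nm Nn.
  have hm : rnorm (y m) ^+ 2 <= (inf E + eta) ^+ 2.
    rewrite ler_pXn2r ?nnegrE ?rnorm_ge0 ?addr_ge0 ?(ltW eta0)//.
    by have := yd m; have := NP m Nm; lra.
  have hn : rnorm (y n) ^+ 2 <= (inf E + eta) ^+ 2.
    rewrite ler_pXn2r ?nnegrE ?rnorm_ge0 ?addr_ge0 ?(ltW eta0)//.
    by have := yd n; have := NP n Nn; lra.
  have mid : (2 * inf E) ^+ 2 <= rnorm (y m + y n) ^+ 2.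
    rewrite ler_pXn2r ?nnegrE ?rnorm_ge0 ?mulr_ge0//.
    have : inf E <= rnorm (2^-1 *: (y m + y n)).
      apply: dU; have -> : x0 - 2^-1 *: (y m + y n) =
          2^-1 *: (x0 - y m) + (2^-1 *: (x0 - y n) + 0).
        rewrite addr0 -scalerDr addrACA -opprD scalerBr -mulr2n -(scaler_nat 2 x0).
        by rewrite scalerA mulVf// scale1r.
      by apply: (Ulin _ _ _ (yU m)); exact: Ulin.
    by rewrite rnormZ -realC_nat -fmorphV rnormR ger0_norm; lra.
  have eta1 : eta <= 1 by rewrite ge_min lexx.
  have eta2 : eta * (8 * (inf E + 1)) <= eps ^+ 2.
    by rewrite -ler_pdivlMr ?ge_min ?lexx ?orbT// mulr_gt0//; lra.
  rewrite -(@ltr_pXn2r _ 2) ?nnegrE ?rnorm_ge0 ?(ltW eps0)// fsym_parallelogram.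
  have : eta ^+ 2 <= eta by rewrite expr2 ler_piMr// ltW.
  nra.
have ld : rnorm l <= inf E.
  apply/ler_addgt0Pr => eps eps0; have e2 : 0 < eps / 2 by lra.
  have [N NP] := lP _ e2; have [M MP] := exp3V_small e2.
  have := NP _ (leq_maxl N M); have := MP _ (leq_maxr N M).
  have := yd (maxn N M); have := rnormD (l - y (maxn N M)) (y (maxn N M)).
  by rewrite subrK; lra.
exists (J l).
  apply/eqP => /(congr1 J); rewrite fsymK linear0 => l0.
  have e2 : 0 < e / 2 by lra.
  have [N /(_ N (leqnn N))] := lP _ e2; rewrite l0 sub0r rnormN.
  by have := eU _ (yU N); rewrite subKr; lra.
move=> u Uu; rewrite -fsym_adj ipC -fsym_adj.
rewrite (@minimal_orth l u) ?conjC0// => t.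
(* [l] need not lie in [x0 + U], so minimality is transferred from [y N] in the limit. *)
apply: le_trans ld _; apply/ler_addgt0Pr => eps eps0.
have [N NP] := lP _ eps0.
have : inf E <= rnorm (y N - t *: u).
  apply: dU; rewrite opprB addrCA; exact: Ulin.
have := rnormD (l - t *: u) (y N - l).
have -> : l - t *: u + (y N - l) = y N - t *: u by rewrite addrC addrA subrK.
by have := NP N (leqnn N); rewrite rnormB; lra.
Qed.

(* Gliding hump: [x n.+1 := x n +- 3 ^- n *: J (y n) / |y n|] pairs with [y n] in
   absolute value at least [3 ^- n * |y n|], and the later steps cannot undo more
   than half of this. *)
Lemma weakly_bounded (B : set H) :
  (forall x, exists M : R, forall y, B y -> rnorm (ip x y) <= M) ->
  exists M : R, forall y, B y -> rnorm y <= M.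
Proof.
move=> wB; apply: contrapT => nB.
have s0 n : 0 < 3 ^- n :> R by rewrite invr_gt0 exprn_gt0.
have sS n : 3 ^- n = 3 * 3 ^- n.+1 :> R.
  by rewrite exprS invfM mulrA divff ?mul1r.
have /choice[y yP] : forall n, exists y, B y /\ n%:R < 3 ^- n * rnorm y.
  move=> n; apply: contrapT => ny; apply: nB; exists (3 ^+ n * n%:R) => y By.
  rewrite leNgt; apply/negP => lt; apply: ny; exists y; split=> //.
  by rewrite mulrC ltr_pdivlMr ?exprn_gt0// mulrC.
have /choice[f fP] : forall nx : nat * H, exists x',
    rnorm (x' - nx.2) <= 3 ^- nx.1 /\
    3 ^- nx.1 * rnorm (y nx.1) <= rnorm (ip x' (y nx.1)).
  move=> [n x] /=; set z := y n.
  have z0 : rnorm z != 0.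
    apply: contraTneq (proj2 (yP n)) => zz.
    by rewrite -/z zz mulr0 -leNgt ler0n.
  pose c := (3 ^- n / rnorm z)%:C *: J z.
  have nc : rnorm c = 3 ^- n.
    rewrite rnormZ rnormR rnorm_fsym ger0_norm ?divfK//.
    by rewrite divr_ge0 ?rnorm_ge0// ltW.
  have ipc : rnorm (ip c z) = 3 ^- n * rnorm z.
    rewrite ipZl fsym_rnorm -realCM rnormR ger0_norm; last first.
      by rewrite mulr_ge0 ?sqr_ge0// divr_ge0 ?rnorm_ge0// ltW.
    by rewrite expr2 mulrA divfK.
  (* The pairings of [x + c] and [x - c] with [z] differ by [2 * ip c z], of modulus
     [2 * 3 ^- n * |z|], so one of them is large enough. *)
  have [le|lt] := leP (3 ^- n * rnorm z) (rnorm (ip (x + c) z)).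
    by exists (x + c); rewrite addrAC subrr add0r nc.
  exists (x - c); rewrite addrAC subrr add0r rnormN nc; split=> //.
  have := rnormD (ip (x + c) z) (- ip (x - c) z).
  have -> : ip (x + c) z - ip (x - c) z = 2%:R%:C * ip c z.
    by rewrite ipDl ipBl realC_nat; ring.
  by rewrite rnormM rnormR rnormN ipc normr_nat; lra.
pose x := fix x n : H := if n is m.+1 then f (m, x m) else 0.
have xP n : rnorm (x n.+1 - x n) <= 3 ^- n by case: (fP (n, x n)).
have ipx n : 3 ^- n * rnorm (y n) <= rnorm (ip (x n.+1) (y n)).
  by case: (fP (n, x n)).
(* Geometric series: the steps made after [x n.+1] have total length at most half of [3 ^- n]. *)
have tail n k : rnorm (x (n + k).+1 - x n.+1) <= (3 ^- n - 3 ^- (n + k)) / 2.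
  elim: k => [|k ih]; first by rewrite addn0 !subrr mul0r /rnorm normr0.
  have := rnorm_dist (x (n + k.+1).+1) (x (n + k).+1) (x n.+1).
  have := xP (n + k.+1)%N; have := sS (n + k)%N.
  by rewrite !addnS in ih *; lra.
have {}tail n m : (n < m)%N -> rnorm (x m - x n.+1) <= 3 ^- n / 2.
  move=> nm; have := tail n (m - n.+1)%N; rewrite -addSn subnKC//.
  by have := s0 (n + (m - n.+1))%N; lra.
have [l lP] : exists l, forall eps : R, 0 < eps -> exists N, forall n, (N <= n)%N ->
     rnorm (l - x n) < eps.
  apply: cauchy_rnorm => eps eps0; have [N NP] := exp3V_small eps0.
  exists N.+1 => m n Nm Nn; have := rnorm_dist (x m) (x N.+1) (x n).
  have := tail _ _ Nm; have := tail _ _ Nn; rewrite [rnorm (x n - _)]rnormB.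
  by have := NP N (leqnn N); lra.
have lx n : rnorm (l - x n.+1) <= 3 ^- n / 2.
  apply/ler_addgt0Pr => eps eps0; have [N NP] := lP _ eps0.
  have := rnorm_dist l (x (maxn N n.+1)) (x n.+1).
  by have := NP _ (leq_maxl N n.+1); have := tail _ _ (leq_maxr N n.+1); lra.
have [M MP] := wB l.
(* As [n + 1 > 2 M], the pairing of [l] with [y n.+1], at least half of
   [3 ^- n.+1 * |y n.+1| > n + 1], exceeds [M]. *)
pose n := Num.truncn (2 * M).
have := MP _ (proj1 (yP n.+1)); have := proj2 (yP n.+1).
have := ipx n.+1; have := krein_CauchySchwarz (l - x n.+2) (y n.+1).
have := ler_wpM2r (rnorm_ge0 (y n.+1)) (lx n.+1).
have := rnormD (ip l (y n.+1)) (- ip (l - x n.+2) (y n.+1)).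
have -> : ip l (y n.+1) - ip (l - x n.+2) (y n.+1) = ip (x n.+2) (y n.+1).
  by rewrite ipBl subKr.
have := truncnS_gt (2 * M); rewrite -/n rnormN; lra.
Qed.

End KreinSpace.

(** For [y] in [D] with norm at most 1, the vectors [z] are weakly bounded, because
    [|ip1 x z| = |ip2 (T x) y| <= |T x|]; so they are bounded in norm, and [T x] is estimated by
    testing it against such [y]. *)
Lemma hellinger_toeplitz (R : realType) (H1 H2 : completeNormedModType R[i])
    (ip1 : {hermitian H1 for false & Num.conj})
    (ip2 : {hermitian H2 for false & Num.conj}) (T : H1 -> H2) (D : set H2) :
  krein ip1 -> krein ip2 -> dense D ->
  (forall y, D y -> exists z, forall x, ip2 (T x) y = ip1 x z) ->
  exists M : R, forall x, rnorm (T x) <= M * rnorm x.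
Proof.
move=> [J1 J1P] [J2 J2P] dD TD.
pose B := [set z | exists2 y, rnorm y <= 1 & forall x, ip2 (T x) y = ip1 x z].
have [x|M MP] := @weakly_bounded _ _ _ _ J1P B.
  exists (rnorm (T x)) => z [y y1 <-].
  apply: le_trans (krein_CauchySchwarz J2P _ _) _.
  by rewrite ler_piMr ?rnorm_ge0.
(* The vector [v] below pairs with [t] to [|t| / 2]; moving it by less than 1/4 into [D] loses at
   most [|t| / 4], which leaves [|t| / 4 <= |M| * |x|]. *)
exists (4 * `|M|) => x; set t := T x.
have [t0|t0] := eqVneq (rnorm t) 0.
  by rewrite t0 mulr_ge0 ?rnorm_ge0// mulr_ge0.
pose v := (2 * rnorm t)^-1%:C *: J2 t.
have nv : rnorm v = 2^-1.
  rewrite rnormZ rnormR (rnorm_fsym J2P) ger0_norm; last first.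
    by rewrite invr_ge0 mulr_ge0 ?rnorm_ge0.
  by rewrite invfM mulfVK.
have q0 : 0 < 4^-1%:C :> R[i] by rewrite ltcR invr_gt0.
have [y [yv Dy]] : (ball v 4^-1%:C `&` D) !=set0.
  by apply: dD; [exists v; exact: ballxx|exact: ball_open].
move: yv; rewrite -ball_normE/= rnormE ltcR => yv.
have [z zP] := TD _ Dy.
have y1 : rnorm y <= 1.
  by have := rnormD v (y - v); rewrite addrC subrK rnormB nv; lra.
have := MP z (ex_intro2 _ _ y y1 zP); have := krein_CauchySchwarz J1P x z.
rewrite -zP -/t => yz zM.
have := krein_CauchySchwarz J2P t (v - y).
have := rnormD (ip2 t (v - y)) (ip2 t y).
rewrite -ipDr subrK ipZr -(fsym_adj J2P) (fsym_rnorm J2P) conjC_real -realCM.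
rewrite rnormR ger0_norm; last by rewrite mulr_ge0 ?sqr_ge0// invr_ge0 mulr_ge0 ?rnorm_ge0.
have -> : (2 * rnorm t)^-1 * rnorm t ^+ 2 = rnorm t / 2 by field.
have := ler_wpM2l (rnorm_ge0 t) (ltW yv).
have := ler_wpM2l (rnorm_ge0 x) (le_trans zM (ler_norm M)).
lra.
Qed.

(** * Algebraic tools: polynomials and maps linear on a subspace *)

Lemma poly_eq0_punctured (F : numDomainType) (p : {poly F}) :
  (forall w, w != 0 -> p.[w] = 0) -> p = 0.
Proof.
move=> p0; apply/eqP; apply: contraT => pn0.
(* The nonzero points [1, ..., size p] are more roots than the degree allows. *)
pose rs := [seq i.+1%:R : F | i <- iota 0 (size p)].
have := @max_poly_roots _ p rs pn0.
rewrite size_map size_iota ltnn; apply.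
  by apply/allP => _ /mapP[i _ ->]; rewrite rootE p0// pnatr_eq0.
rewrite map_inj_uniq ?iota_uniq// => i j /eqP.
by rewrite eqr_nat => /eqP[].
Qed.

(** [q] is coprime to ['X], so ['X^(N.+1)] divides [g]. *)
Lemma coef_eq0_of_mulXn (F : fieldType) (q g h : {poly F}) N :
  q.[0] != 0 -> q * g + 'X^(N.+1) * h = 0 -> g`_N = 0.
Proof.
move=> q0 /eqP; rewrite addr_eq0 => /eqP qg.
have : dvdp 'X^(N.+1) g.
  have : dvdp 'X^(N.+1) (q * g) by rewrite qg dvdpNr dvdp_mulr.
  rewrite Gauss_dvdpr// coprimep_expl// coprimep_sym coprimepX.
  by rewrite rootE.
move=> /dvdpP[r ->].
by rewrite coefMXn ltnSn.
Qed.

Section LinearOn.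
Variables (R : realType) (X Y : lmodType R[i]) (W : set X).
Hypothesis Wlin : lin_subspace W.

(** Linearity is relative to [W] because a boundary mapping is a total function that is linear only
    on S^*. *)
Definition linear_on (f : X -> Y) :=
  forall (a : R[i]) p q, W p -> W q -> f (a *: p + q) = a *: f p + f q.

Lemma lin_subspaceZ a p : W p -> W (a *: p).
Proof. by move=> Wp; rewrite -[a *: p]addr0; apply: Wlin.2 => //; exact: Wlin.1. Qed.

Lemma lin_subspaceD p q : W p -> W q -> W (p + q).
Proof. by move=> Wp Wq; rewrite -[p]scale1r; exact: Wlin.2. Qed.

Lemma lin_subspaceB p q : W p -> W q -> W (p - q).
Proof. by move=> Wp Wq; rewrite addrC -scaleN1r; exact: Wlin.2. Qed.

Lemma lin_subspace_sum (I : Type) (s : seq I) (c : I -> R[i]) (p : I -> X) :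
  (forall i, W (p i)) -> W (\sum_(i <- s) c i *: p i).
Proof.
move=> Wp; elim: s => [|i s ih]; first by rewrite big_nil; exact: Wlin.1.
by rewrite big_cons; exact: Wlin.2.
Qed.

Variable f : X -> Y.
Hypothesis flin : linear_on f.

Lemma linear_on0 : f 0 = 0.
Proof.
have := flin 1 Wlin.1 Wlin.1.
by rewrite !scale1r addr0 -[X in X = _]addr0 => /addrI.
Qed.

Lemma linear_onZ a p : W p -> f (a *: p) = a *: f p.
Proof.
move=> Wp; rewrite -[a *: p]addr0 (flin _ Wp Wlin.1) linear_on0 addr0//.
Qed.

Lemma linear_onD p q : W p -> W q -> f (p + q) = f p + f q.
Proof. by move=> Wp Wq; rewrite -{1}[p]scale1r flin// scale1r. Qed.

Lemma linear_onB p q : W p -> W q -> f (p - q) = f p - f q.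
Proof. by move=> Wp Wq; rewrite addrC -scaleN1r flin// scaleN1r addrC. Qed.

Lemma linear_on_sum (I : Type) (s : seq I) (c : I -> R[i]) (p : I -> X) :
  (forall i, W (p i)) ->
  f (\sum_(i <- s) c i *: p i) = \sum_(i <- s) c i *: f (p i).
Proof.
move=> Wp; elim: s => [|i s ih]; first by rewrite !big_nil linear_on0.
by rewrite !big_cons flin ?ih//; exact: lin_subspace_sum.
Qed.

End LinearOn.

(** Among matrices with row space inside [W] (up to transposition) take one of maximal rank. By
    maximality its rows span [W], and the annihilator condition then makes it invertible. *)
Lemma lin_subspace_full (R : realType) n (W : set 'cV[R[i]]_n) :
  lin_subspace W ->
  (forall c : 'rV_n, (forall w, W w -> c *m w = 0) -> c = 0) ->
  forall w, W w.
Proof.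
move=> Wlin Wann.
pose Pk k := `[< exists B : 'M[R[i]]_n, (forall u, W (u *m B)^T) /\ \rank B = k >].
have P0 : exists k, Pk k.
  exists 0%N; apply/asboolP; exists 0; split; last by rewrite mxrank0.
  by move=> u; rewrite mulmx0 trmx0; exact: Wlin.1.
have Pn k : Pk k -> (k <= n)%N by move=> /asboolP[B [_ <-]]; exact: rank_leq_row.
have [k /asboolP[B [BW Bk]] kmax] := ex_maxnP P0 Pn.
have WB w : W w -> (w^T <= B)%MS.
  move=> Ww; apply: contraT => wB.
  have /rank_ltmx : (B < B + w^T)%MS.
    rewrite ltmxE addsmxSl/=; apply: contra wB; apply: submx_trans.
    exact: addsmxSr.
  rewrite Bk ltnNge kmax//; apply/asboolP; exists (B + w^T)%MS; split=> // u.
  have /sub_addsmxP[[u1 u2] /= ->] : (u *m (B + w^T)%MS <= B + w^T)%MS.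
    exact: submxMl.
  rewrite linearD/= addrC [X in X + _]trmx_mul trmxK [u2]mx11_scalar tr_scalar_mx.
  by rewrite mul_mx_scalar; exact: Wlin.2.
have Bu : B \in unitmx.
  rewrite -unitmx_tr -row_free_unit -kermx_eq0; apply/eqP/row_matrixP => i.
  rewrite row0; apply: Wann => w /WB/submxP[D].
  move=> /(congr1 trmx); rewrite trmxK trmx_mul => ->.
  by rewrite mulmxA -row_mul mulmx_ker row0 mul0mx.
by move=> w; have := BW (w^T *m invmx B); rewrite mulmxKV// trmxK.
Qed.

(** * Linear pencils: polynomial solutions, lifting of chains, dimension count *)

Section Pencil.
Variables (R : realType) (X : lmodType R[i]) (W : set X) (n k : nat).
Hypothesis Wlin : lin_subspace W.
Variables (alpha beta : X -> 'cV[R[i]]_n) (gamma : X -> 'cV[R[i]]_k).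
Hypotheses (alphal : linear_on W alpha) (betal : linear_on W beta).
Hypothesis (gammal : linear_on W gamma).
Hypothesis beta_surj : forall c, exists2 p, W p & beta p = c.

(* The infinite solution [x N, K c0, K E c0, ...] of the recursion, K being a
   right inverse of beta and E = alpha K, is summed by Cramer's rule for
   [1 - w E]: this gives a solution of [beta y = w alpha y] which is polynomial
   in w and agrees with [q * (x 0 + w x 1 + ... + w ^ N x N)] up to order N. *)
Lemma pencil_chain_coef m (M : 'M[{poly R[i]}]_(m, k)) :
  (forall w, w != 0 -> forall p, W p -> beta p = w *: alpha p ->
     mxpoly_at M w *m gamma p = 0) ->
  forall (x : nat -> X) N, (forall j, W (x j)) -> beta (x 0%N) = 0 ->
    (forall j, (j < N)%N -> beta (x j.+1) = alpha (x j)) ->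
  \sum_(j < N.+1) map_mx (coefp j) M *m gamma (x (N - j)%N) = 0.
Proof.
move=> Mker x N Wx x0 xS.
have /choice[p pP] : forall i : 'I_n, exists p, W p /\ beta p = delta_mx i 0.
  by move=> i; have [p Wp pE] := beta_surj (delta_mx i 0); exists p.
have Wp i : W (p i) by case: (pP i).
pose K (c : 'cV[R[i]]_n) := \sum_i c i 0 *: p i.
have WK c : W (K c) by exact: lin_subspace_sum.
have betaK c : beta (K c) = c.
  rewrite (linear_on_sum Wlin betal _ _ Wp); apply/colP => i.
  rewrite summxE (bigD1 i)//= big1 => [|j ji]; last first.
    by rewrite (proj2 (pP j)) !mxE eq_sym (negbTE ji) mulr0.
  by rewrite (proj2 (pP i)) !mxE !eqxx mulr1 addr0.
pose E := \matrix_(i < n, j < n) alpha (p j) i 0.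
pose G := \matrix_(i < k, j < n) gamma (p j) i 0.
have alphaK c : alpha (K c) = E *m c.
  rewrite (linear_on_sum Wlin alphal _ _ Wp); apply/colP => i.
  by rewrite summxE mxE; apply: eq_bigr => j _; rewrite !mxE mulrC.
have gammaK c : gamma (K c) = G *m c.
  rewrite (linear_on_sum Wlin gammal _ _ Wp); apply/colP => i.
  by rewrite summxE mxE; apply: eq_bigr => j _; rewrite !mxE mulrC.
pose c0 := alpha (x N).
pose Dp : 'M[{poly R[i]}]_n := 1%:M - 'X *: map_mx polyC E.
pose q := \det Dp.
have Dpw w : map_mx (horner_eval w) Dp = 1%:M - w *: E.
  rewrite map_mxB map_scalar_mx/= map_mxZ/= /horner_eval hornerX hornerC.
  by congr (_ - _ *: _); apply/matrixP => i j; rewrite !mxE hornerC.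
have adjw w : (1%:M - w *: E) *m map_mx (horner_eval w) (\adj Dp) = q.[w]%:M.
  by rewrite -Dpw -map_mxM/= mul_mx_adj map_scalar_mx.
(* [V] collects the values [gamma (x j)] as coefficients and [U] comes from the Cramer tail;
   [gamma (y w)] is the value at [w] of [q *: V + 'X^(N.+1) *: U]. *)
pose V : 'cV[{poly R[i]}]_k := \col_i \poly_(j < N.+1) gamma (x j) i 0.
pose U := map_mx polyC G *m \adj Dp *m map_mx polyC c0.
pose y w := q.[w] *: (\sum_(j < N.+1) w ^+ j *: x j) +
            w ^+ N.+1 *: K (map_mx (horner_eval w) (\adj Dp) *m c0).
have Wsum w : W (\sum_(j < N.+1) w ^+ j *: x j) by exact: lin_subspace_sum.
have Wy w : W (y w) by apply: Wlin.2; [|exact: lin_subspaceZ].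
have fy w (l : nat) (f : X -> 'cV_l) : linear_on W f -> f (y w) =
    q.[w] *: (\sum_(j < N.+1) w ^+ j *: f (x j)) +
    w ^+ N.+1 *: f (K (map_mx (horner_eval w) (\adj Dp) *m c0)).
  move=> fl; rewrite fl//; last exact: lin_subspaceZ.
  by rewrite (linear_onZ Wlin fl)// (linear_on_sum Wlin fl).
have betay w : beta (y w) = w *: alpha (y w).
  apply/eqP; rewrite -subr_eq0 !fy// betaK alphaK !scalerDr.
  rewrite big_ord_recl/= x0 scaler0 add0r big_ord_recr/= scalerDr -/c0.
  rewrite [w *: (_ + _)]scalerDr opprD addrACA.
  have -> : \sum_(i < N) w ^+ bump 0 i *: beta (x (bump 0 i)) =
      w *: \sum_(i < N) w ^+ i *: alpha (x i).
    by rewrite scaler_sumr; apply: eq_bigr => i _; rewrite scalerA -exprS xS.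
  have : (1%:M - w *: E) *m (map_mx (horner_eval w) (\adj Dp) *m c0) = q.[w] *: c0.
    by rewrite mulmxA adjw mul_scalar_mx.
  move: (map_mx _ _ *m c0) => a; rewrite mulmxBl mul1mx -scalemxAl => aE.
  have -> : w ^+ N.+1 *: a - w *: (w ^+ N.+1 *: (E *m a)) = (w ^+ N.+1 * q.[w]) *: c0.
    by rewrite -[RHS]scalerA -aE scalerBr !scalerA mulrC.
  rewrite !scalerA opprD addrA [w * q.[w]]mulrC subrr add0r -scaleNr -scalerDl exprS.
  by rewrite [_ + _](_ : _ = 0) ?scale0r//; ring.
have evZ w (c : {poly R[i]}) (B : 'cV[{poly R[i]}]_k) :
    map_mx (horner_eval w) (c *: B) = c.[w] *: map_mx (horner_eval w) B.
  by apply/colP => i; rewrite !mxE; exact: hornerM.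
have evC w l1 l2 (B : 'M[R[i]]_(l1, l2)) : map_mx (horner_eval w) (map_mx polyC B) = B.
  by apply/matrixP => i j; rewrite !mxE; exact: hornerC.
have gy w : gamma (y w) = map_mx (horner_eval w) (q *: V + 'X^(N.+1) *: U).
  rewrite fy// gammaK map_mxD !evZ hornerXn /U !map_mxM !evC mulmxA.
  congr (_ *: _ + _); apply/colP => i; rewrite summxE !mxE.
  rewrite [RHS]horner_poly; apply: eq_bigr => j _; rewrite mxE mulrC//.
have MU0 : M *m (q *: V + 'X^(N.+1) *: U) = 0.
  apply/matrixP => i j; rewrite [RHS]mxE; apply: poly_eq0_punctured => w w0.
  have := Mker w w0 _ (Wy w) (betay w); rewrite gy -[mxpoly_at _ _]/(map_mx (horner_eval w) M).
  by rewrite -map_mxM => /matrixP/(_ i j); rewrite !mxE.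
apply/colP => i; rewrite summxE [RHS]mxE.
have q0 : q.[0] != 0.
  have := Dpw 0; rewrite scale0r subr0 => D0.
  by rewrite -[q.[0]]/(horner_eval 0 q) -det_map_mx D0 det1 oner_eq0.
have qg : q * (M *m V) i 0 + 'X^(N.+1) * (M *m U) i 0 = 0.
  move/matrixP: MU0 => /(_ i 0).
  by rewrite mulmxDr -!scalemxAr mxE [X in X + _]mxE [X in _ + X]mxE [RHS]mxE.
transitivity ((M *m V) i 0)`_N; last exact: coef_eq0_of_mulXn q0 qg.
rewrite [in RHS]mxE coef_sum.
under [RHS]eq_bigr do rewrite coefM.
rewrite exchange_big/=; apply: eq_bigr => j _; rewrite mxE; apply: eq_bigr => l _.
by rewrite !mxE coef_poly ltnS leq_subr.
Qed.

(** Induction on the length. Extend the lift by any [p] with [beta p = alpha (x N)]. Comparing the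
    boundary conditions of order [N + 1] of this extension and of [v], the lower terms cancel and
    [M 0] annihilates [v N.+1 - gamma p]; an element of the kernel of [beta] corrects [p]. *)
Lemma pencil_chain_lift m (M : nat -> 'M[R[i]]_(m, k)) :
  (forall v, M 0%N *m v = 0 -> exists2 p, W p & beta p = 0 /\ gamma p = v) ->
  (forall (x : nat -> X) N, (forall j, W (x j)) -> beta (x 0%N) = 0 ->
     (forall j, (j < N)%N -> beta (x j.+1) = alpha (x j)) ->
     \sum_(j < N.+1) M j *m gamma (x (N - j)%N) = 0) ->
  forall (v : nat -> 'cV[R[i]]_k) N,
    (forall l, (l <= N)%N -> \sum_(j < l.+1) M j *m v (l - j)%N = 0) ->
  exists x : nat -> X, [/\ forall j, W (x j), beta (x 0%N) = 0,
    forall j, (j < N)%N -> beta (x j.+1) = alpha (x j)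
    & forall j, (j <= N)%N -> gamma (x j) = v j].
Proof.
move=> exact0 coef v; elim=> [|N ih] vP.
  have /exact0[p Wp [bp gp]] : M 0%N *m v 0%N = 0.
    by have := vP 0%N (leqnn _); rewrite big_ord1.
  by exists (fun=> p); split=> // -[].
have [x [Wx x0 xS xv]] := ih (fun l lN => vP l (leqW lN)).
have [p Wp bp] := beta_surj (alpha (x N)).
pose y q j := if (j <= N)%N then x j else p + q.
have yS q : beta q = 0 -> W q -> forall j, (j < N.+1)%N -> beta (y q j.+1) = alpha (y q j).
  move=> bq Wq j; rewrite ltnS /y => jN; rewrite jN; case: ltnP => [/xS//|Nj].
  have -> : j = N by apply/eqP; rewrite eqn_leq jN.
  by rewrite (linear_onD betal)// bq addr0.
have Wy q : W q -> forall j, W (y q j).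
  by move=> Wq j; rewrite /y; case: ifP => // _; exact: lin_subspaceD.
have W0 := Wlin.1.
have /exact0[q Wq [bq gq]] : M 0%N *m (v N.+1 - gamma p) = 0.
  have := coef (y 0) N.+1 (Wy _ W0) x0 (yS 0 (linear_on0 Wlin betal) W0).
  rewrite big_ord_recl/= subn0 {1}/y ltnn addr0 => yE.
  have := vP _ (leqnn N.+1); rewrite big_ord_recl/= subn0 => vE; move: (etrans vE (esym yE)).
  have -> : \sum_(i < N.+1) M (bump 0 i) *m gamma (y 0 (N.+1 - bump 0 i)%N) =
            \sum_(i < N.+1) M (bump 0 i) *m v (N.+1 - bump 0 i)%N.
    by apply: eq_bigr => i _; rewrite /y subSS leq_subr xv ?leq_subr.
  by move=> /addIr E; rewrite mulmxBr E subrr.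
exists (y q); split=> //.
- exact: Wy.
- exact: yS.
move=> j; rewrite /y leq_eqVlt ltnS => /predU1P[->|jN]; last by rewrite jN xv.
by rewrite ltnn (linear_onD gammal)// gq addrC subrK.
Qed.

(** On a space of dimension [n + r], with [r] the dimension of the kernel of [M0], the map [alpha]
    has a kernel of dimension at least [r]. There [gamma] is injective with values in the kernel of
    [Minf], of dimension [r] too, so it is onto. *)
Lemma kernel_of_equal_rank m (M0 Minf : 'M[R[i]]_(m, k)) :
  (forall v, M0 *m v = 0 -> exists2 p, W p & beta p = 0 /\ gamma p = v) ->
  (forall p, W p -> alpha p = 0 -> gamma p = 0 -> beta p = 0) ->
  (forall p, W p -> alpha p = 0 -> Minf *m gamma p = 0) ->
  \rank Minf = \rank M0 ->
  forall v, Minf *m v = 0 -> exists2 p, W p & alpha p = 0 /\ gamma p = v.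
Proof.
move=> exact0 inj ker rk v Mv.
pose B := row_base (kermx M0^T).
pose r : nat := \rank (kermx M0^T).
have /choice[p pP] : forall i : 'I_n, exists p, W p /\ beta p = delta_mx i 0.
  by move=> i; have [p Wp pE] := beta_surj (delta_mx i 0); exists p.
have /choice[t tP] : forall j : 'I_r, exists p, [/\ W p, beta p = 0 & gamma p = (row j B)^T].
  move=> j; have [|q Wq [bq gq]] := exact0 (row j B)^T; last by exists q.
  apply: trmx_inj; rewrite trmx_mul trmxK trmx0; apply/sub_kermxP.
  by apply: submx_trans (row_sub _ _) _; rewrite eq_row_base.
pose s (i : 'I_(n + r)) := match fintype.split i with inl i => p i | inr j => t j end.
have Ws i : W (s i).
  by rewrite /s; case: fintype.split => j; [case: (pP j)|case: (tP j)].
pose comb (c : 'rV[R[i]]_(n + r)) := \sum_i c 0 i *: s i.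
have Wcomb c : W (comb c) by exact: lin_subspace_sum.
pose Al := \matrix_(i < n + r, l < n) alpha (s i) l 0.
pose Ga := \matrix_(i < n + r, l < k) gamma (s i) l 0.
have AlE c : (alpha (comb c))^T = c *m Al.
  rewrite (linear_on_sum Wlin alphal _ _ Ws); apply/rowP => l.
  by rewrite mxE summxE mxE; apply: eq_bigr => i _; rewrite !mxE.
have GaE c : (gamma (comb c))^T = c *m Ga.
  rewrite (linear_on_sum Wlin gammal _ _ Ws); apply/rowP => l.
  by rewrite mxE summxE mxE; apply: eq_bigr => i _; rewrite !mxE.
(* [inj] gives [beta (comb c) = 0], which kills the coefficients of the [p i]; those of the [t j]
   vanish since [gamma] sends the [t j] to a basis. *)
have ker0 (c : 'rV[R[i]]_(n + r)) : c *m Al = 0 -> c *m Ga = 0 -> c = 0.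
  rewrite -AlE -GaE => /(congr1 trmx); rewrite trmxK trmx0 => a0.
  move=> /(congr1 trmx); rewrite trmxK trmx0 => g0.
  have b0 := inj _ (Wcomb c) a0 g0.
  have cl i : c 0 (lshift r i) = 0.
    move/colP: b0 => /(_ i); rewrite (linear_on_sum Wlin betal _ _ Ws) summxE.
    rewrite big_split_ord/= [X in _ + X]big1 => [|j _]; last first.
      rewrite /s (unsplitK (inr j)) mxE; case: (tP j) => _ -> _.
      by rewrite mxE mulr0.
    rewrite (bigD1 i)//= big1 => [|j ji]; last first.
      rewrite /s (unsplitK (inl j)) mxE; case: (pP j) => _ ->.
      by rewrite mxE eq_sym (negbTE ji) mulr0.
    rewrite /s (unsplitK (inl i)) mxE; case: (pP i) => _ ->.
    by rewrite !mxE !eqxx !addr0 mulr1.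
  have cr : rsubmx c = 0.
    apply: (row_free_inj (row_base_free (kermx M0^T))); rewrite mul0mx.
    apply: trmx_inj; rewrite trmx0 -[RHS]g0 (linear_on_sum Wlin gammal _ _ Ws).
    apply/colP => l; rewrite summxE big_split_ord/= [X in X + _]big1 => [|j _]; last first.
      by rewrite cl scale0r mxE.
    rewrite add0r !mxE; apply: eq_bigr => j _; rewrite /s (unsplitK (inr j)).
    by case: (tP j) => _ _ ->; rewrite !mxE.
  apply/rowP => i; rewrite mxE; case: (splitP i) => j ij.
    by rewrite (_ : i = lshift r j) ?cl//; exact: val_inj.
  rewrite (_ : i = rshift n j); last exact: val_inj.
  by move/rowP: cr => /(_ j); rewrite !mxE.
have rK : \rank (kermx Al *m Ga) = \rank (kermx Al).
  rewrite -[RHS](mxrank_mul_ker _ Ga) (_ : (_ :&: _)%MS = 0) ?mxrank0 ?addn0//.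
  apply/eqP; rewrite -submx0; apply/rV_subP => c; rewrite sub_capmx.
  by move=> /andP[/sub_kermxP c1 /sub_kermxP c2]; rewrite (ker0 c)// sub0mx.
have sub : (kermx Al *m Ga <= kermx Minf^T)%MS.
  apply/row_subP => i; apply/sub_kermxP; rewrite row_mul -GaE -trmx_mul.
  rewrite ker ?trmx0//; apply: trmx_inj; rewrite trmx0 AlE -row_mul mulmx_ker row0//.
have full : (kermx Minf^T <= kermx Al *m Ga)%MS.
  rewrite -(geq_leqif (mxrank_leqif_sup sub)) rK !mxrank_ker !mxrank_tr rk.
  have <- : r = (k - \rank M0)%N by rewrite /r mxrank_ker mxrank_tr.
  by rewrite -addnBAC ?rank_leq_col// leq_addl.
have /submx_trans/(_ full)/submxP[c vE] : (v^T <= kermx Minf^T)%MS.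
  by apply/sub_kermxP; rewrite -trmx_mul Mv trmx0.
exists (comb (c *m kermx Al)) => //; split; apply: trmx_inj.
  by rewrite AlE trmx0 -mulmxA mulmx_ker mulmx0.
by rewrite GaE vE mulmxA.
Qed.

End Pencil.

(** * Local coordinates at a point of the extended plane *)

Section PencilCoordinates.
Variables (R : realType) (V : lmodType R[i]).
Implicit Types (z : option R[i]) (u r : V) (p : V * V).

(** [A (zpair z u r)] says that [(u, r)] is in A - z, or in the inverse of A at infinity; this
    treats finite points and infinity alike. *)
Definition zpair z u r : V * V :=
  if z is Some l then (u, l *: u + r) else (r, u).

Definition zdom z p : V := if z is Some _ then p.1 else p.2.

Definition zran z p : V := if z is Some l then p.2 - l *: p.1 else p.1.

Lemma zpairK z p : zpair z (zdom z p) (zran z p) = p.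
Proof. by case: z p => [l|] [f g] //=; rewrite addrC subrK. Qed.

Lemma zdom_pair z u r : zdom z (zpair z u r) = u.
Proof. by case: z. Qed.

Lemma zran_pair z u r : zran z (zpair z u r) = r.
Proof. by case: z => //= l; rewrite addrC addKr. Qed.

Lemma zpairP z a u u' r r' :
  zpair z (a *: u + u') (a *: r + r') = a *: zpair z u r + zpair z u' r'.
Proof.
case: z => // l; congr (_, _) => /=.
by rewrite !scalerDr addrACA !scalerA mulrC.
Qed.

Lemma zpairB z u u' r r' :
  zpair z (u - u') (r - r') = zpair z u r - zpair z u' r'.
Proof.
by rewrite [RHS]addrC -[- zpair _ _ _]scaleN1r -zpairP !scaleN1r !(addrC (- _)).
Qed.

Lemma zpair0 z : zpair z 0 0 = 0.
Proof. by case: z => // l; rewrite /zpair scaler0 addr0. Qed.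

Lemma zdomP z a p q : zdom z (a *: p + q) = a *: zdom z p + zdom z q.
Proof. by case: z. Qed.

Lemma zranP z a p q : zran z (a *: p + q) = a *: zran z p + zran z q.
Proof.
case: z => // l /=.
by rewrite scalerBr scalerDr opprD addrACA !scalerA mulrC.
Qed.

End PencilCoordinates.

Section SpectrumCoordinates.
Variables (R : realType) (V : completeNormedModType R[i]).
Implicit Types (z : option R[i]) (A : set (V * V)).

Definition zrange A z : set V := [set r | exists u, A (zpair z u r)].

Lemma rel_shiftE A l : rel_shift A l = [set p | A (zpair (Some l) p.1 p.2)].
Proof.
apply/seteqP; split=> [_ [[f g] Ap <-]|[u r] /= Ap].
  by rewrite /= addrC subrK.
by exists (u, l *: u + r) => //=; rewrite addrC addKr.
Qed.

(** At infinity the relation shifted is the inverse and the shift is by 0, so both cases are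
    predicates of the same local relation. *)
Lemma extendE (X : set (V * V) -> R[i] -> Prop) (Y : set (V * V) -> Prop) A z :
  (forall B l, X B l = Y (rel_shift B l)) ->
  extend X A z = Y [set p | A (zpair z p.1 p.2)].
Proof.
move=> XY; case: z => [l|]; rewrite /extend /= XY rel_shiftE//.
by congr Y; apply/seteqP; split=> -[u r] /=; rewrite /rel_inv/= scale0r add0r.
Qed.

Lemma sp_pE A z : sp_p A z = ([set u | A (zpair z u 0)] <> [set 0]).
Proof. exact: (@extendE _ (fun B => rel_nul B <> [set 0])). Qed.

Lemma resE A z : res A z = ([set u | A (zpair z u 0)] = [set 0] /\
  everywhere_bounded_operator [set p | A (zpair z p.2 p.1)]).
Proof.
exact: (@extendE _ (fun B => rel_nul B = [set 0] /\
  everywhere_bounded_operator (rel_inv B))).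
Qed.

Lemma sp_cE A z : sp_c A z = [/\ [set u | A (zpair z u 0)] = [set 0],
  dense (zrange A z) & zrange A z <> setT].
Proof.
exact: (@extendE _ (fun B => [/\ rel_nul B = [set 0], dense (rel_ran B)
  & rel_ran B <> setT])).
Qed.

Lemma sp_rE A z : sp_r A z =
  ([set u | A (zpair z u 0)] = [set 0] /\ ~ dense (zrange A z)).
Proof.
exact: (@extendE _ (fun B => rel_nul B = [set 0] /\ ~ dense (rel_ran B))).
Qed.

Lemma sp_pP A z : lin_subspace A -> sp_p A z <-> exists2 u, u != 0 & A (zpair z u 0).
Proof.
move=> Alin; rewrite sp_pE; split=> [nA|[u u0 Au]]; last first.
  by move=> E; move: u0 => /eqP; apply; have : [set u | A (zpair z u 0)] u by []; rewrite E.
apply: contrapT => nu; apply: nA; apply/seteqP; split=> [u Au|_ ->].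
  by apply: contrapT => /eqP u0; apply: nu; exists u.
by rewrite /= zpair0; exact: Alin.1.
Qed.

Lemma not_sp_p A z : ~ sp_p A z <-> [set u | A (zpair z u 0)] = [set 0].
Proof. by rewrite sp_pE; split=> [/contrapT|->]//; apply. Qed.

Lemma chain_pairE z s k : chain_pair z s k = zpair z s`_k (0 :: s)`_k :> V * V.
Proof. by []. Qed.

End SpectrumCoordinates.

Section LocalPolynomial.
Variables (R : realType) (m n : nat) (P : 'M[{poly R[i]}]_(m, n)).
Implicit Type z : option R[i].

(* At infinity the local coordinate is 1/z; multiplying row i by the power
   row_degree P i of it does not change the kernels. *)
Definition mxpoly_local z : 'M[{poly R[i]}]_(m, n) :=
  if z is Some l then map_mx (fun p => p \Po ('X + l%:P)) P else row_reversal P.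

Lemma mxpoly_local_finite l w :
  mxpoly_at (mxpoly_local (Some l)) w = mxpoly_at P (w + l).
Proof. by apply/matrixP => i j; rewrite !mxE horner_comp !hornerE. Qed.

(** Brings the derivatives in the chain conditions to the coefficient form of
    [pencil_chain_coef]. *)
Lemma mxpoly_local_taylor z j :
  mxpoly_taylor P z j = map_mx (coefp j) (mxpoly_local z).
Proof.
have coefE (p : {poly R[i]}) : p^`(j).[0] = j`!%:R * p`_j.
  by rewrite mulr_natl horner_coef0 coef_derivn addn0 ffactnn.
have derivE (p : {poly R[i]}) l : (p \Po ('X + l%:P))^`(j) = p^`(j) \Po ('X + l%:P).
  elim: j {coefE} => [|j ih]; first by rewrite !derivn0.
  by rewrite !derivnS ih deriv_comp derivD derivX derivC addr0 mulr1.
have j0 : j`!%:R != 0 :> R[i] by rewrite pnatr_eq0 -lt0n fact_gt0.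
apply/matrixP => i k; case: z => [l|]; rewrite !mxE/=.
  have -> : (P i k)^`(j).[l] = ((P i k) \Po ('X + l%:P))^`(j).[0].
    by rewrite derivE horner_comp !hornerE.
  by rewrite coefE mulKf.
by rewrite coefE mulKf.
Qed.

End LocalPolynomial.

(** * Krein subspaces and self-adjoint relations *)

Section KreinSubspaceTheory.
Variables (R : realType) (H Ht : completeNormedModType R[i]).
Variables (ip : {hermitian H for false & Num.conj}).
Variables (ipt : {hermitian Ht for false & Num.conj}).
Variables (iota : {linear H -> Ht}).
Hypotheses (kH : krein ip) (kHt : krein ipt) (kS : krein_subspace ip ipt iota).

Local Notation Hhat := (orth_compl ipt iota).
Local Notation Pr := (orth_proj ipt iota).

Lemma orth_compl_lin : lin_subspace Hhat.
Proof.
split=> [h|a x y xH yH h]; first by rewrite linear0l.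
by rewrite ipDl ipZl xH yH mulr0 addr0.
Qed.

Lemma orth_projP x : Hhat (x - iota (Pr x)).
Proof. by have [_ /(_ x)] := kS; exact: xgetPex. Qed.

Lemma iota_adj h x : ipt (iota h) x = ip h (Pr x).
Proof.
have [iso _] := kS; rewrite -[LHS]subr0 -(conjC0 R[i]) -(orth_projP x h).
by rewrite -ipC ipBr iso subKr.
Qed.

Lemma proj_adj x h : ip (Pr x) h = ipt x (iota h).
Proof. by rewrite ipC -iota_adj -ipC. Qed.

Lemma orth_proj_unique x h : Hhat (x - iota h) -> Pr x = h.
Proof.
move=> xh; have [J JP] := kH; apply/subr0_eq/(krein_nondeg JP) => k.
have [iso _] := kS.
by have := xh k; rewrite ipBl iso ipBl proj_adj.
Qed.

Lemma orth_projK h : Pr (iota h) = h.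
Proof. by apply: orth_proj_unique; rewrite subrr; exact: orth_compl_lin.1. Qed.

Lemma orth_projP_lin a x y : Pr (a *: x + y) = a *: Pr x + Pr y.
Proof.
apply: orth_proj_unique; rewrite linearP opprD addrACA -scalerBr.
by apply: orth_compl_lin.2; exact: orth_projP.
Qed.

Lemma orth_proj_eq0 x : Pr x = 0 <-> Hhat x.
Proof.
split=> [x0|xH]; first by have := orth_projP x; rewrite x0 linear0 subr0.
by apply: orth_proj_unique; rewrite linear0 subr0.
Qed.

(** [krein_subspace] is purely algebraic; boundedness comes from [iota] and the projection being
    adjoint to each other everywhere. *)
Lemma iota_bounded : exists M : R, forall h, rnorm (iota h) <= M * rnorm h.
Proof.
apply: (@hellinger_toeplitz _ _ _ ip ipt iota setT) => //.
  by move=> G G0 _; rewrite setIT.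
by move=> x _; exists (Pr x) => h; rewrite iota_adj.
Qed.

Lemma orth_proj_bounded : exists M : R, forall x, rnorm (Pr x) <= M * rnorm x.
Proof.
apply: (@hellinger_toeplitz _ _ _ ipt ip Pr setT) => //.
  by move=> G G0 _; rewrite setIT.
by move=> h _; exists (iota h) => x; rewrite proj_adj.
Qed.

End KreinSubspaceTheory.

Section SelfAdjoint.
Variables (R : realType) (V : completeNormedModType R[i]).
Variables (ip : {hermitian V for false & Num.conj}) (A : set (V * V)).
Hypothesis (kV : krein ip) (sA : selfadjoint_rel ip A).
Implicit Type z : option R[i].

Local Notation zconj := (omap (Num.conj : R[i] -> R[i])).

Lemma rel_adj_lin (B : set (V * V)) : lin_subspace (rel_adj ip B).
Proof.
split=> [f g _|a p q Bp Bq f g Bfg]; first by rewrite !linear0r.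
by rewrite /= !ipDr !ipZr (Bp _ _ Bfg) (Bq _ _ Bfg).
Qed.

Lemma selfadjoint_lin : lin_subspace A.
Proof. by rewrite sA; exact: rel_adj_lin. Qed.

Lemma selfadjoint_pairing z u r v s :
  A (zpair z u r) -> A (zpair (zconj z) v s) -> ip r v = ip u s.
Proof.
rewrite {2}sA => Au Av; case: z Au Av => [l|] Au /(_ _ _ Au)//=.
by rewrite ipDl ipZl ipDr ipZr conjCK => /addrI.
Qed.

(** The orthogonal complement of the range of A - z is the kernel of its adjoint A - z^*. *)
Lemma selfadjoint_orth z x :
  (forall r, zrange A z r -> ip r x = 0) -> A (zpair (zconj z) x 0).
Proof.
rewrite {2}sA => xO; case: z xO => [l|] xO f g Afg /=.
  rewrite addr0 ipZr conjCK; apply/subr0_eq; rewrite -ipZl -ipBl.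
  by apply: xO; exists f; rewrite /= addrC subrK.
by rewrite linear0r; apply/esym/xO; exists g.
Qed.

Lemma zrange_lin (B : set (V * V)) z : lin_subspace B -> lin_subspace (zrange B z).
Proof.
move=> [B0 Blin]; split=> [|a r s [u Bu] [v Bv]].
  by exists 0; rewrite zpair0.
by exists (a *: u + v); rewrite zpairP; exact: Blin.
Qed.

(* Outside the point spectrum the range of A - z is dense as soon as A - z^*
   has no kernel; the adjoint of the inverse is then densely defined. *)
Lemma selfadjoint_bounded z :
  ~ sp_p A z -> zrange A z = setT -> dense (zrange A (zconj z)) ->
  everywhere_bounded_operator [set p | A (zpair z p.2 p.1)].
Proof.
move=> /not_sp_p nul ran dn.
have /choice[T TP] : forall r, exists u, A (zpair z u r).
  by move=> r; have : zrange A z r by rewrite ran.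
have inj u v r : A (zpair z u r) -> A (zpair z v r) -> u = v.
  move=> Au Av; apply/subr0_eq.
  have : [set u | A (zpair z u 0)] (u - v).
    by rewrite /= -(subrr r) zpairB; exact: lin_subspaceB selfadjoint_lin _ _ _ _.
  by rewrite nul.
have Tlin : linear T.
  by move=> a x y; apply: (inj _ _ _ (TP _)); rewrite zpairP; exact: selfadjoint_lin.2.
pose Tl : {linear V -> V} := HB.pack T (GRing.isLinear.Build _ _ _ _ _ Tlin).
exists Tl; split.
  have [y [v Av]|M MP] := @hellinger_toeplitz _ _ _ ip ip T _ kV kV dn.
    by exists v => x; rewrite (selfadjoint_pairing (TP x) Av).
  by exists M%:C => f; rewrite !rnormE -realCM lecR; exact: MP.
move=> f g /=; split=> [Ag|->]; last exact: TP.
exact: inj Ag (TP f).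
Qed.

End SelfAdjoint.

(** * The boundary problem as a compression of A *)

Section BoundaryEigenvalueProblem.
Variables (R : realType) (H Ht : completeNormedModType R[i]).
Variables (ip : {hermitian H for false & Num.conj}).
Variables (ipt : {hermitian Ht for false & Num.conj}).
Variables (iota : {linear H -> Ht}) (S : set (H * H)) (d : nat).
Variables (b : H * H -> 'cV[R[i]]_(2 * d)) (P : 'M[{poly R[i]}]_(d, 2 * d)).
Variable A : set (Ht * Ht).

Local Notation Hhat := (orth_compl ipt iota).
Local Notation Pr := (orth_proj ipt iota).
Local Notation zconj := (omap (Num.conj : R[i] -> R[i])).

Hypotheses (kH : krein ip) (kHt : krein ipt) (kS : krein_subspace ip ipt iota).
Hypothesis sA : selfadjoint_rel ipt A.
Hypothesis SA : forall f g, S (f, g) -> A (iota f, iota g).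
Hypothesis bP : boundary_mapping ip S b.
Hypothesis hat_nul : forall z x, Hhat x -> A (zpair z x 0) -> x = 0.
Hypothesis rankP : forall z, \rank (mxpoly_ext P z) = d.
Hypothesis shP : forall l : R[i], shtraus ipt iota A l = bep_rel ip S b P (Some l).
Variables (n : nat) (e : 'I_n -> Ht).
Hypothesis eH : forall i, Hhat (e i).
Hypothesis e_span :
  forall x, Hhat x -> exists c : 'I_n -> R[i], x = \sum_i c i *: e i.
Hypothesis e_free :
  forall c : 'I_n -> R[i], \sum_i c i *: e i = 0 -> forall i, c i = 0.

Implicit Type z : option R[i].

Let PrL a x y : Pr (a *: x + y) = a *: Pr x + Pr y := orth_projP_lin kH kS a x y.
Let PrK h : Pr (iota h) = h := orth_projK kH kS h.
Let Alin : lin_subspace A := selfadjoint_lin sA.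

Lemma orth_projB x y : Pr (x - y) = Pr x - Pr y.
Proof. by rewrite addrC -scaleN1r PrL scaleN1r addrC. Qed.

Lemma orth_proj0 : Pr 0 = 0.
Proof. by rewrite -(linear0 iota) PrK. Qed.

(* This determines the component of x in the orthogonal complement of H, which
   is nondegenerate; see [hat_coord_inj]. *)
Definition hat_coord (x : Ht) : 'cV[R[i]]_n := \col_i ipt x (e i).

Local Notation co := hat_coord.

Lemma hat_coordP a x y : co (a *: x + y) = a *: co x + co y.
Proof. by apply/colP => i; rewrite !mxE ipDl ipZl. Qed.

Lemma hat_coordB x y : co (x - y) = co x - co y.
Proof. by apply/colP => i; rewrite !mxE ipBl. Qed.

Lemma hat_coord_iota h : co (iota h) = 0.
Proof. by apply/colP => i; rewrite !mxE ipC eH conjC0. Qed.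

Lemma hat_coord0 : co 0 = 0.
Proof. by rewrite -(linear0 iota) hat_coord_iota. Qed.

(** The component of [x] in the complement is orthogonal to [iota] H and to all [e i], so it
    vanishes by nondegeneracy. *)
Lemma hat_coord_eq0 x : co x = 0 -> x = iota (Pr x).
Proof.
move=> x0; apply/subr0_eq; have [J JP] := kHt; apply: (krein_nondeg JP) => y.
have xH := orth_projP kS x.
have -> : y = iota (Pr y) + (y - iota (Pr y)) by rewrite addrC subrK.
rewrite ipDr xH add0r; have [c ->] := e_span (orth_projP kS y).
rewrite ip_sumr big1// => i _; rewrite ipBl [X in _ - X]ipC eH conjC0 subr0.
by move/colP: x0 => /(_ i); rewrite !mxE => ->; rewrite mulr0.
Qed.

Lemma hat_coord_inj x y : co x = co y -> Pr x = Pr y -> x = y.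
Proof.
move=> xy Pxy; apply/subr0_eq; rewrite [LHS]hat_coord_eq0.
  by rewrite orth_projB Pxy subrr linear0.
by rewrite hat_coordB xy subrr.
Qed.

Definition pair_proj (p : Ht * Ht) : H * H := (Pr p.1, Pr p.2).

Local Notation pr := pair_proj.

Lemma pair_projP a p q : pr (a *: p + q) = a *: pr p + pr q.
Proof. by congr (_, _); rewrite PrL. Qed.

Lemma pair_proj_zpair z u r : pr (zpair z u r) = zpair z (Pr u) (Pr r).
Proof. by case: z => // l; rewrite /pr/= PrL. Qed.

Lemma zdom_pair_proj z p : zdom z (pr p) = Pr (zdom z p).
Proof. by case: z. Qed.

Lemma zran_pair_proj z p : zran z (pr p) = Pr (zran z p).
Proof. by rewrite -{1}(zpairK z p) pair_proj_zpair zran_pair. Qed.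

Lemma pair_proj_adj p : A p -> rel_adj ip S (pr p).
Proof.
move=> Ap f g Sfg; rewrite /= -!(iota_adj kS); move: Ap; rewrite sA; apply.
exact: SA.
Qed.

Lemma rel_sub_boundary p q : A p -> S q -> A (p - (iota q.1, iota q.2)).
Proof. by case: q => f g Ap /SA; exact: lin_subspaceB. Qed.

Lemma pair_projS p q : pr (p - (iota q.1, iota q.2)) = pr p - q.
Proof. by case: q => f g; congr (_, _); rewrite /= orth_projB PrK. Qed.

Definition hat_dom z p := co (zdom z p).
Definition hat_ran z p := co (zran z p).
Definition bproj p := b (pr p).

Local Notation alpha := hat_dom.
Local Notation beta := hat_ran.
Local Notation gamma := bproj.

Lemma hat_domS z p (q : H * H) : alpha z (p - (iota q.1, iota q.2)) = alpha z p.
Proof.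
case: q => f g; rewrite /alpha.
have -> : zdom z (p - (iota f, iota g)) = zdom z p - iota (zdom z (f, g)).
  by case: z.
by rewrite hat_coordB hat_coord_iota subr0.
Qed.

Lemma hat_ranS z p (q : H * H) : beta z (p - (iota q.1, iota q.2)) = beta z p.
Proof.
case: q => f g; rewrite /beta.
have -> : zran z (p - (iota f, iota g)) = zran z p - iota (zran z (f, g)).
  case: z => //= l; rewrite [iota (g - _)]linearB [iota (l *: _)]linearZ/=.
  by rewrite scalerBr !opprD !opprK addrACA.
by rewrite hat_coordB hat_coord_iota subr0.
Qed.

Lemma hat_dom_lin z : linear_on A (alpha z).
Proof. by move=> a p q _ _; rewrite /alpha zdomP hat_coordP. Qed.

Lemma hat_ran_lin z : linear_on A (beta z).
Proof. by move=> a p q _ _; rewrite /beta zranP hat_coordP. Qed.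

Lemma bproj_lin : linear_on A gamma.
Proof.
move=> a p q Ap Aq; rewrite /gamma pair_projP.
by have [bl _ _] := bP; apply: bl; exact: pair_proj_adj.
Qed.

(* A vector of the complement orthogonal to the range of A - z lies in the
   kernel of A - z^*. *)
Lemma hat_ran_surj z c : exists2 p, A p & beta z p = c.
Proof.
pose W := [set c | exists2 p, A p & beta z p = c].
apply: (@lin_subspace_full _ _ W) => [|a aW].
  split; first by exists 0; [exact: Alin.1|apply: (linear_on0 Alin); exact: hat_ran_lin].
  move=> a _ _ [p Ap <-] [q Aq <-].
  by exists (a *: p + q); [exact: Alin.2|rewrite hat_ran_lin].
(* Pairing with [x] is the functional [a] on coordinates; the conjugates compensate for the
   antilinear second argument. *)
pose x := \sum_i Num.conj (a 0 i) *: e i.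
have xH : Hhat x by apply: (lin_subspace_sum (orth_compl_lin ipt iota)); exact: eH.
have x0 : x = 0.
  apply: (@hat_nul (zconj z)) => //; apply: (selfadjoint_orth sA) => r [u Aur].
  have /aW/matrixP/(_ 0 0) : W (beta z (zpair z u r)) by exists (zpair z u r).
  rewrite !mxE => <-; rewrite ip_sumr; apply: eq_bigr => i _.
  by rewrite conjCK mxE zran_pair.
apply/rowP => i; rewrite mxE; apply: (can_inj conjCK).
by rewrite (e_free x0) conjC0.
Qed.

Local Notation M := (mxpoly_local P).

(** [beta (Some l) p = 0] puts [p.2 - l *: p.1] in H, so [pr p] is in the Shtraus subspace at
    [l]. *)
Lemma hat_ran0_ker l p : A p -> beta (Some l) p = 0 -> mxpoly_at P l *m gamma p = 0.
Proof.
move=> Ap /hat_coord_eq0 rp.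
have : shtraus ipt iota A l (pr p).
  by exists p => //; split=> //; exists (Pr (zran (Some l) p)).
by rewrite shP => -[].
Qed.

(** The pencil equation at local coordinate [w] says that [beta] vanishes at the point [w + l], or
    [w^-1] when [z] is infinity. *)
Lemma local_ker z w : w != 0 -> forall p, A p -> beta z p = w *: alpha z p ->
  mxpoly_at (M z) w *m gamma p = 0.
Proof.
move=> w0 p Ap; case: z => [l|] bp.
  rewrite mxpoly_local_finite; apply: hat_ran0_ker => //.
  have -> : beta (Some (w + l)) p = co (- w *: p.1 + zran (Some l) p).
    by congr co; rewrite /= scalerDl opprD scaleNr addrCA.
  by rewrite hat_coordP -[co (zran _ _)]/(beta _ _) bp -scalerDl addNr scale0r.
rewrite row_reversalE// -mulmxA [_ *m gamma p]hat_ran0_ker ?mulmx0//.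
rewrite /beta/= addrC -scaleNr hat_coordP -[co p.1]/(beta None p) bp.
by rewrite scalerA mulNr mulVf// scaleN1r addNr.
Qed.

Lemma local_chain z (x : nat -> Ht * Ht) N : (forall j, A (x j)) ->
  beta z (x 0%N) = 0 ->
  (forall j, (j < N)%N -> beta z (x j.+1) = alpha z (x j)) ->
  \sum_(j < N.+1) mxpoly_taylor P z j *m gamma (x (N - j)%N) = 0.
Proof.
move=> Ax x0 xS.
under eq_bigr do rewrite mxpoly_local_taylor.
exact: (pencil_chain_coef Alin (hat_dom_lin z) (hat_ran_lin z) bproj_lin
  (hat_ran_surj z) (@local_ker z)).
Qed.

Lemma mxpoly_taylor0 z : mxpoly_taylor P z 0 = mxpoly_ext P z.
Proof.
by rewrite /mxpoly_taylor invr1 scale1r; case: z => [l|];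
  congr mxpoly_at; apply/matrixP => i j; rewrite !mxE.
Qed.

(** A chain of length one; this reaches infinity, where the hypothesis on Shtraus subspaces says
    nothing directly. *)
Lemma hat_ran0_ext z p : A p -> beta z p = 0 -> mxpoly_ext P z *m gamma p = 0.
Proof.
move=> Ap p0; have := @local_chain z (fun=> p) 0 (fun=> Ap) p0.
by rewrite big_ord1 mxpoly_taylor0; apply.
Qed.

Lemma ext_ker_finite l v : mxpoly_at P l *m v = 0 ->
  exists2 p, A p & beta (Some l) p = 0 /\ gamma p = v.
Proof.
have [_ /(_ v)[q Sq <-] _] := bP => Pv.
have : shtraus ipt iota A l q by rewrite shP.
move=> [p [Ap [h _ hE]] <-]; exists p => //; split=> //.
by rewrite /beta/= -hE hat_coord_iota.
Qed.

(** At infinity the roles of alpha and beta in the dimension count are played by [beta None] and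
    [beta (Some 0)]. *)
Lemma ext_ker z v : mxpoly_ext P z *m v = 0 ->
  exists2 p, A p & beta z p = 0 /\ gamma p = v.
Proof.
case: z => [l|]; first exact: ext_ker_finite.
have hs c : exists2 p, A p & beta (Some 0) p = c by exact: hat_ran_surj.
apply: (@kernel_of_equal_rank _ _ _ _ _ Alin (beta None) (beta (Some 0)) gamma
  (hat_ran_lin _) (hat_ran_lin _) bproj_lin hs _ (mxpoly_at P 0)).
- by move=> w; exact: ext_ker_finite.
(* Here [pr p] lies in S; subtracting its image leaves a pair {0, g} of A with g in the complement,
   hence the zero pair. *)
- move=> p Ap p0 g0.
  have Sp : S (pr p) by have [_ _ bS] := bP; apply/bS => //; exact: pair_proj_adj.
  have Aq := rel_sub_boundary Ap Sp.
  have : p - (iota (pr p).1, iota (pr p).2) = 0.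
    have q1 : p.1 - iota (Pr p.1) = 0 by rewrite -(hat_coord_eq0 p0) subrr.
    have q2 : p.2 - iota (Pr p.2) = 0.
      apply: (@hat_nul None); first exact: orth_projP kS _.
      by move: Aq; rewrite /zpair -q1.
    by congr (_, _).
  rewrite -(hat_ranS (Some 0) p (pr p)) => ->.
  by rewrite (linear_on0 Alin (hat_ran_lin _)).
- by move=> p Ap p0; exact: (@hat_ran0_ext None).
- by rewrite (rankP None) (rankP (Some 0)).
Qed.

(** [pr p - q] is in the kernel S of [b]; subtracting its image in A changes neither [alpha] nor
    [beta]. *)
Lemma match_boundary p q : A p -> rel_adj ip S q -> gamma p = b q ->
  exists p', [/\ A p', pr p' = q & forall z, alpha z p' = alpha z p /\ beta z p' = beta z p].
Proof.
move=> Ap Sq pq.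
have Sd : S (pr p - q).
  have [bl _ bS] := bP.
  have adj : rel_adj ip S (pr p - q).
    by apply: lin_subspaceB (rel_adj_lin _ _) _ _ _ Sq; exact: pair_proj_adj.
  apply/bS => //; have : linear_on (rel_adj ip S) b by move=> *; exact: bl.
  move=> /linear_onB ->//; last exact: pair_proj_adj.
  by rewrite -pq subrr.
exists (p - (iota (pr p - q).1, iota (pr p - q).2)); split.
- exact: rel_sub_boundary.
- by rewrite pair_projS subKr.
- by move=> z; rewrite hat_domS hat_ranS.
Qed.

(** Extends the equality of Shtraus subspaces and boundary relations to infinity. *)
Lemma bep_relP z q : bep_rel ip S b P z q <-> exists p, [/\ A p, pr p = q & beta z p = 0].
Proof.
split=> [[Sq Pq]|[p [Ap <- p0]]]; last first.
  by split; [exact: pair_proj_adj|exact: hat_ran0_ext].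
have [p Ap [p0 pq]] := ext_ker Pq.
have [p' [Ap' pq' p'p]] := match_boundary Ap Sq pq.
by exists p'; split=> //; rewrite (proj2 (p'p z)).
Qed.

Lemma bep_rel_zpair z u r :
  bep_rel ip S b P z (zpair z u r) <-> exists2 x, A (zpair z x (iota r)) & Pr x = u.
Proof.
split=> [/bep_relP[p [Ap pq p0]]|[x Ax <-]].
  exists (zdom z p); last by rewrite -zdom_pair_proj pq zdom_pair.
  have <- : zran z p = iota r; last by rewrite zpairK.
  by rewrite (hat_coord_eq0 p0) -zran_pair_proj pq zran_pair.
apply/bep_relP; exists (zpair z x (iota r)); split=> //.
  by rewrite pair_proj_zpair PrK.
by rewrite /beta zran_pair hat_coord_iota.
Qed.

Lemma bep_rel_lin z : lin_subspace (bep_rel ip S b P z).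
Proof.
split=> [|a p q]; first by apply/bep_relP; exists 0; split;
  [exact: Alin.1|congr (_, _); exact: orth_proj0|apply: (linear_on0 Alin); exact: hat_ran_lin].
move=> /bep_relP[p' [Ap <- p0]] /bep_relP[q' [Aq <- q0]]; apply/bep_relP.
exists (a *: p' + q'); split; [exact: Alin.2|exact: pair_projP|].
by rewrite hat_ran_lin// p0 q0 scaler0 addr0.
Qed.

Lemma zpair_kernel_proj z x : A (zpair z x 0) -> Pr x = 0 -> x = 0.
Proof. by move=> Ax /(orth_proj_eq0 kH kS) xH; exact: hat_nul Ax. Qed.

Lemma bep_sp_pE : bep_sp_p ip S b P = sp_p A.
Proof.
apply/seteqP; split=> z /=.
  move=> /(sp_pP _ (bep_rel_lin z))[u u0 /bep_rel_zpair[x]].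
  rewrite linear0 => Ax xu; apply/(sp_pP _ Alin); exists x => //.
  by apply: contraNneq u0 => x0; rewrite -xu x0 orth_proj0.
move=> /(sp_pP _ Alin)[x x0 Ax]; apply/(sp_pP _ (bep_rel_lin z)).
exists (Pr x); last by apply/bep_rel_zpair; exists x => //; rewrite linear0.
by apply: contra_neq x0; exact: zpair_kernel_proj Ax.
Qed.

Lemma zrange_bepE z r : zrange (bep_rel ip S b P z) z r <-> zrange A z (iota r).
Proof.
split=> [[u /bep_rel_zpair[x Ax _]]|[x Ax]]; first by exists x.
by exists (Pr x); apply/bep_rel_zpair; exists x.
Qed.

(** Since [beta z] is onto, any [r] can be moved into H by subtracting the range entry of an element
    of A. *)
Lemma zrange_bepT z : zrange (bep_rel ip S b P z) z = setT <-> zrange A z = setT.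
Proof.
split=> rT; apply/seteqP; split=> // r _; last by apply/zrange_bepE; rewrite rT.
have [p Ap pr] := hat_ran_surj z (co r).
have rp : r - zran z p = iota (Pr (r - zran z p)).
  by apply: hat_coord_eq0; rewrite hat_coordB -/(beta z p) pr subrr.
have [x Ax] : zrange A z (r - zran z p).
  by rewrite rp; apply/zrange_bepE; rewrite rT.
exists (1 *: x + zdom z p); rewrite -[r](subrK (zran z p)) -[r - _]scale1r zpairP.
by apply: Alin.2 => //; rewrite zpairK.
Qed.

(* A vector x orthogonal to the range of the boundary problem can be completed,
   by a component in the complement, to a vector orthogonal to the range of
   A - z. *)
Lemma zrange_bep_dense z : ~ sp_p A (zconj z) -> dense (zrange (bep_rel ip S b P z) z).
Proof.
move=> nz; apply: contrapT => nd; have [J JP] := kH.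
have [x x0 xO] := exists_orthogonal JP (zrange_lin z (bep_rel_lin z)) nd.
apply: nz; apply/(sp_pP _ Alin).
have /choice[p pP] : forall i, exists p, A p /\ beta z p = delta_mx i 0.
  by move=> i; have [p Ap pi] := hat_ran_surj z (delta_mx i 0); exists p.
have Ap i : A (p i) by case: (pP i).
pose a i := - Num.conj (ipt (zran z (p i)) (iota x)).
pose y := iota x + \sum_i a i *: e i.
have Pry : Pr y = x.
  rewrite /y addrC -[iota x](scale1r) addrC PrL scale1r PrK addrC.
  rewrite (proj2 (orth_proj_eq0 kH kS _)) ?add0r//.
  by apply: (lin_subspace_sum (orth_compl_lin ipt iota)); exact: eH.
exists y; first by apply: contraNneq x0 => y0; rewrite -Pry y0 orth_proj0.
apply: (selfadjoint_orth sA) => r [u Aur].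
have yp i : ipt (zran z (p i)) y = 0.
  rewrite ipDr ip_sumr (bigD1 i)//= big1 => [|j ji].
    have -> : ipt (zran z (p i)) (e i) = 1.
      by have /colP/(_ i) := proj2 (pP i); rewrite !mxE !eqxx.
    by rewrite /a rmorphN/= conjCK mulr1 addr0 subrr.
  have -> : ipt (zran z (p i)) (e j) = 0.
    by have /colP/(_ j) := proj2 (pP i); rewrite !mxE (negbTE ji).
  by rewrite mulr0.
pose q := \sum_i co r i 0 *: p i.
have Aq : A q by exact: lin_subspace_sum.
have bq : beta z q = co r.
  rewrite (linear_on_sum Alin (hat_ran_lin z) _ _ Ap); apply/colP => i.
  rewrite summxE (bigD1 i)//= big1 => [|j ji].
    by have := proj2 (pP i); rewrite mxE => ->; rewrite !mxE !eqxx mulr1 addr0.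
  by have := proj2 (pP j); rewrite mxE => ->; rewrite !mxE eq_sym (negbTE ji) mulr0.
have rq : zran z q = \sum_i co r i 0 *: zran z (p i).
  have zl : linear_on A (zran z) by move=> *; exact: zranP.
  exact: (linear_on_sum Alin zl _ _ Ap).
have rqE : r - zran z q = iota (Pr (r - zran z q)).
  by apply: hat_coord_eq0; rewrite hat_coordB -/(beta z q) bq subrr.
have q0 : ipt (zran z q) y = 0.
  rewrite rq ipC ip_sumr big1 ?conjC0// => i _.
  by rewrite [ipt y _]ipC yp conjC0 mulr0.
rewrite -[r](subrK (zran z q)) ipDl q0 addr0 rqE (iota_adj kS) Pry.
apply: xO; apply/zrange_bepE; rewrite -rqE; exists (u - zdom z q).
by rewrite zpairB zpairK; exact: lin_subspaceB.
Qed.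

(** * Projection and lifting of Jordan chains *)

Lemma nth_map_proj s k : (map Pr s)`_k = Pr s`_k.
Proof.
have [ks|sk] := ltnP k (size s); first exact: nth_map.
by rewrite !nth_default ?size_map ?orth_proj0.
Qed.

Lemma pair_proj_chain z s k : pr (chain_pair z s k) = chain_pair z (map Pr s) k.
Proof.
rewrite !chain_pairE pair_proj_zpair nth_map_proj.
by case: k => [|k] /=; rewrite ?nth_map_proj ?orth_proj0.
Qed.

Lemma jordan_chain_proj z s :
  jordan_chain A z s -> bep_jordan_chain ip S b P z (map Pr s).
Proof.
move=> [s0 h0 As]; split.
- by case: s s0 {h0 As}.
- rewrite nth_map_proj; apply: contra_neq h0; apply: (@zpair_kernel_proj z).
  by apply: (As 0%N); case: s s0 {As}.
move=> k; rewrite size_map => ks; split.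
  by rewrite -pair_proj_chain; exact: pair_proj_adj (As k ks).
under eq_bigr => j _ do rewrite -pair_proj_chain -[b _]/(gamma _).
(* [local_chain] wants an infinite sequence; the padding by 0 lies beyond the indices read. *)
pose x j := if (j < size s)%N then chain_pair z s j else 0.
rewrite -[RHS](@local_chain z x k) => [|j||j jk].
- apply: eq_bigr => j _; rewrite /x ifT//.
  exact: leq_ltn_trans (leq_subr _ _) ks.
- by rewrite /x; case: ifP => [/As//|_]; exact: Alin.1.
- rewrite /x (leq_ltn_trans (leq0n k) ks) /beta chain_pairE zran_pair.
  exact: hat_coord0.
rewrite /x (leq_ltn_trans jk ks) (ltn_trans jk ks) /beta /alpha !chain_pairE.
by rewrite zran_pair zdom_pair.
Qed.

(** Once the preceding entries agree, the difference of the next ones lies in the kernel of A - z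
    (of the inverse of A at infinity) and projects to 0. *)
Lemma jordan_chain_proj_inj z s s' : jordan_chain A z s -> jordan_chain A z s' ->
  map Pr s = map Pr s' -> s = s'.
Proof.
move=> [_ _ As] [_ _ As'] ss'.
have sz : size s = size s' by rewrite -(size_map Pr) ss' size_map.
apply: (@eq_from_nth _ 0) => //; elim=> [|k ih] ks.
  apply/subr0_eq; apply: (@zpair_kernel_proj z).
    rewrite -[X in zpair z _ X](subrr (0 : Ht)) zpairB.
    by apply: lin_subspaceB; [exact: Alin|exact: (As 0%N)|apply: (As' 0%N); rewrite -sz].
  by rewrite orth_projB -!nth_map_proj ss' subrr.
apply/subr0_eq; apply: (@zpair_kernel_proj z).
  have -> : zpair z (s`_k.+1 - s'`_k.+1) 0 = chain_pair z s k.+1 - chain_pair z s' k.+1.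
    by rewrite !chain_pairE/= -zpairB (ih (ltnW ks)) subrr.
  by apply: lin_subspaceB; [exact: Alin|exact: (As k.+1)|apply: (As' k.+1); rewrite -sz].
by rewrite orth_projB -!nth_map_proj ss' subrr.
Qed.

(** The boundary values of [f] are lifted by [pencil_chain_lift], then [match_boundary] adjusts the
    projections to those of [f]. *)
Lemma jordan_chain_lift z f :
  bep_jordan_chain ip S b P z f -> exists2 s, jordan_chain A z s & map Pr s = f.
Proof.
move=> [f0 h0 Bf]; set N := (size f).-1.
have fN : size f = N.+1 by rewrite prednK// lt0n size_eq0.
have [||y [Ay y0 yS yv]] := @pencil_chain_lift _ _ _ _ _ Alin (alpha z) (beta z) gamma
    (hat_ran_lin z) bproj_lin (hat_ran_surj z) _ (mxpoly_taylor P z) _ (@local_chain z)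
    (fun j => b (chain_pair z f j)) N.
- by move=> v; rewrite mxpoly_taylor0; exact: ext_ker.
- by move=> l lN; apply: (proj2 (Bf l _)); rewrite fN.
have /choice[x xP] : forall j, exists p, (j <= N)%N ->
    [/\ A p, pr p = chain_pair z f j & alpha z p = alpha z (y j) /\ beta z p = beta z (y j)].
  move=> j; have [jN|] := leqP j N; last by exists 0.
  have [|p [Ap pf pz]] := match_boundary (q := chain_pair z f j) (Ay j) _ (yv j jN).
    by apply: (proj1 (Bf j _)); rewrite fN.
  by exists p.
pose s := mkseq (fun j => zdom z (x j)) (size f).
have sf : map Pr s = f.
  apply: (@eq_from_nth _ 0); rewrite size_map size_mkseq// => j jf.
  rewrite nth_map_proj nth_mkseq// -zdom_pair_proj.
  have jN : (j <= N)%N by rewrite -ltnS -fN.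
  by have [_ -> _] := xP j jN; rewrite chain_pairE zdom_pair.
exists s => //; split.
- by rewrite -size_eq0 size_mkseq size_eq0.
- by apply: contra_neq h0 => s00; rewrite -sf nth_map_proj s00 orth_proj0.
move=> k; rewrite size_mkseq => kf.
have kN : (k <= N)%N by rewrite -ltnS -fN.
have [Ax xf [xa xb]] := xP k kN.
(* The range entry of [x k] must equal the preceding vector of [s]: their coordinates agree by the
   recursion, their projections by the choice of [x]. *)
suff -> : chain_pair z s k = x k by [].
rewrite chain_pairE -[RHS](zpairK z) [s`_k]nth_mkseq//; congr zpair.
have ranx : Pr (zran z (x k)) = (0 :: f)`_k by rewrite -zran_pair_proj xf chain_pairE zran_pair.
apply: hat_coord_inj.
  rewrite -[RHS]/(beta z (x k)) xb; case: k kf kN {xf ranx Ax xa xb} => [|k] kf kN /=.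
    by rewrite y0 hat_coord0.
  rewrite yS// nth_mkseq ?(ltnW kf)//.
  by have [_ _ [<- _]] := xP k (ltnW kN).
rewrite ranx -sf; case: k {kf kN xf ranx Ax xa xb} => [|k] /=; first exact: orth_proj0.
by rewrite nth_map_proj.
Qed.

(** * Resolvent set, continuous and residual spectrum *)

Lemma zrange_dense z : ~ sp_p A (zconj z) -> dense (zrange A z).
Proof.
move=> nz; apply: contrapT => nd; have [J JP] := kHt.
have [x x0 xO] := exists_orthogonal JP (zrange_lin z Alin) nd.
apply: nz; apply/(sp_pP _ Alin); exists x => //.
by apply: (selfadjoint_orth sA) => r; exact: xO.
Qed.

Lemma bep_solutionE z h f :
  bep_solution ip S b P z h f <-> bep_rel ip S b P z (zpair z f h).
Proof.
case: z => [l|//]; split=> [[g [Sfg gh Pfg]]|[Sfh Pfh]].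
  by rewrite /zpair -gh addrC subrK.
by exists (l *: f + h); split=> //; rewrite addrC addKr.
Qed.

Lemma rel_appE (V : completeNormedModType R[i]) (B : set (V * V)) f g :
  (forall g', B (f, g') <-> g' = g) -> rel_app B f = g.
Proof.
move=> Bf; apply/Bf; have : exists g', B (f, g') by exists g; exact/Bf.
exact: xgetPex.
Qed.

Section SymmetricPointSpectrum.
Hypothesis symA : sp_p A = conj_set (sp_p A).

Lemma not_sp_p_conj z : ~ sp_p A z -> ~ sp_p A (zconj z).
Proof.
rewrite {2}symA => nz [z' Az' zz]; apply: nz; suff <- : z' = z by [].
case: z z' zz {Az'} => [l|] [l'|] //= [] /(congr1 Num.conj).
by rewrite !conjCK => ->.
Qed.

Lemma resP z : res A z <-> ~ sp_p A z /\ zrange A z = setT.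
Proof.
rewrite resE not_sp_p; split=> -[nul].
  move=> [T [_ TP]]; split=> //; apply/seteqP; split=> // r _.
  by exists (T r); apply: (proj2 (TP r (T r))).
move=> rT; split=> //.
apply: (selfadjoint_bounded kHt sA) => //; first exact/not_sp_p.
(* Density is needed at z^*, so the excluded eigenvalue is the double conjugate of z. *)
by apply: zrange_dense; apply: not_sp_p_conj; apply: not_sp_p_conj; exact/not_sp_p.
Qed.

Lemma resolvent_op z : res A z -> exists T : {linear Ht -> Ht},
  (exists N : R, forall f, rnorm (T f) <= N * rnorm f) /\
  forall u r, A (zpair z u r) <-> u = T r.
Proof.
rewrite resE => -[_ [T [[N NP] TP]]]; exists T; split=> [|u r]; last exact: TP.
(* [N] is a complex number; since [N * |f|] is nonnegative, [N] may be replaced by its modulus. *)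
exists (rnorm N) => f; have Tf := NP f.
have /ger0_norm := le_trans (normr_ge0 _) Tf.
rewrite normrM normr_id => NE; move: Tf; rewrite -NE !rnormE -realCM lecR.
by [].
Qed.

Lemma bep_nulE z :
  ([set u | bep_rel ip S b P z (zpair z u 0)] = [set 0]) <-> ~ sp_p A z.
Proof. by rewrite -not_sp_p -[sp_p _ z]/(bep_sp_p ip S b P z) bep_sp_pE. Qed.

Lemma bep_resP z : res (bep_rel ip S b P z) z <-> ~ sp_p A z /\ zrange A z = setT.
Proof.
rewrite resE bep_nulE; split=> -[nul].
  move=> [T [_ TP]]; split=> //; apply/zrange_bepT/seteqP; split=> // r _.
  by exists (T r); apply: (proj2 (TP r (T r))).
move=> rT; split=> //.
have [T [[N NP] TP]] : exists T : {linear Ht -> Ht},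
  (exists N : R, forall f, rnorm (T f) <= N * rnorm f) /\
  forall u r, A (zpair z u r) <-> u = T r by apply: resolvent_op; exact/resP.
have [N1 N1P] := iota_bounded kH kHt kS; have [N2 N2P] := orth_proj_bounded kH kHt kS.
(* The solution operator of the boundary problem is the compression to H of the resolvent of A. *)
pose G h := Pr (T (iota h)).
have Glin : linear G by move=> a x y; rewrite /G !linearP PrL.
exists (HB.pack G (GRing.isLinear.Build _ _ _ _ _ Glin) : {linear H -> H}); split.
  exists (`|N2| * `|N| * `|N1|)%:C => f; rewrite !rnormE -realCM lecR /=.
  apply: le_trans (N2P _) _; apply: le_trans (ler_wpM2r (rnorm_ge0 _) (ler_norm _)) _.
  rewrite -!mulrA ler_wpM2l//; apply: le_trans (NP _) _.
  apply: le_trans (ler_wpM2r (rnorm_ge0 _) (ler_norm _)) _.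
  rewrite ler_wpM2l//; apply: le_trans (N1P _) _.
  by rewrite ler_wpM2r ?rnorm_ge0// ler_norm.
move=> f g; rewrite /=; split=> [/bep_rel_zpair[x /TP -> <-]//|->].
by apply/bep_rel_zpair; exists (T (iota f)) => //; exact/TP.
Qed.

Lemma sp_cP z : sp_c A z <-> ~ sp_p A z /\ zrange A z <> setT.
Proof.
rewrite sp_cE; split=> [[/not_sp_p nz _ rT]|[/not_sp_p nz rT]]; split=> //.
by apply: zrange_dense; apply: not_sp_p_conj; exact/not_sp_p.
Qed.

Lemma sp_rP z : ~ sp_r A z.
Proof.
rewrite sp_rE => -[/not_sp_p nz]; apply; apply: zrange_dense.
exact: not_sp_p_conj.
Qed.

Lemma bep_sp_cP z : sp_c (bep_rel ip S b P z) z <-> ~ sp_p A z /\ zrange A z <> setT.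
Proof.
rewrite sp_cE; split=> [[/bep_nulE nz _ rT]|[nz rT]]; split=> //.
- by move=> rA; apply: rT; apply/zrange_bepT.
- exact/bep_nulE.
- by apply: zrange_bep_dense; exact: not_sp_p_conj.
- by move=> /zrange_bepT.
Qed.

Lemma bep_sp_rP z : ~ sp_r (bep_rel ip S b P z) z.
Proof.
rewrite sp_rE => -[/bep_nulE nz]; apply; apply: zrange_bep_dense.
exact: not_sp_p_conj.
Qed.

Lemma bep_solutionP z h f : res (bep_rel ip S b P z) z ->
  bep_solution ip S b P z h f <->
  f = Pr (match z with
          | Some l => rel_app (rel_inv (rel_shift A l)) (iota h)
          | None => rel_app A (iota h)
          end).
Proof.
move=> /bep_resP/resP/resolvent_op[T [_ TP]].
have -> : match z with
    | Some l => rel_app (rel_inv (rel_shift A l)) (iota h)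
    | None => rel_app A (iota h)
    end = T (iota h).
  by case: z TP => [l|] TP; apply: rel_appE => g; rewrite -TP// /rel_inv rel_shiftE.
rewrite bep_solutionE; split=> [/bep_rel_zpair[x /TP -> <-]//|->].
by apply/bep_rel_zpair; exists (T (iota h)) => //; exact/TP.
Qed.

End SymmetricPointSpectrum.

(** * The bijection of chains and maximality *)

Lemma jordan_chain_bij z :
  set_bij (jordan_chain A z) (bep_jordan_chain ip S b P z) (map Pr).
Proof.
split=> [s|s s' /set_mem As /set_mem As'|f /jordan_chain_lift[s As sf]].
- exact: jordan_chain_proj.
- exact: jordan_chain_proj_inj As As'.
- by exists s.
Qed.

Lemma jordan_chain_rcons z s h :
  s != [::] -> jordan_chain A z (rcons s h) -> jordan_chain A z s.
Proof.
move=> s0 [_ h0 As]; split=> //.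
  by move: h0; rewrite nth_rcons lt0n size_eq0 s0.
move=> k ks; have := As k; rewrite size_rcons => /(_ (ltnW ks)).
suff -> : chain_pair z (rcons s h) k = chain_pair z s k by [].
rewrite !chain_pairE nth_rcons ks; congr zpair.
by case: k ks => [|k] //= ks; rewrite nth_rcons (ltnW ks).
Qed.

(** An extension of the projected chain lifts to a chain of A; dropping its last vector gives [s]
    back, by injectivity. *)
Lemma maximal_chain_proj z s : jordan_chain A z s ->
  maximal_chain (jordan_chain A z) s <->
  maximal_chain (bep_jordan_chain ip S b P z) (map Pr s).
Proof.
move=> As; split=> -[_ maxs]; split=> //; first exact: jordan_chain_proj.
  move=> [f /jordan_chain_lift[s' As' s'f]]; apply: maxs.
  case/lastP: s' s'f As' => [|s' h] s'f As'; first by case: (map Pr s) s'f.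
  move: s'f; rewrite map_rcons => /rcons_inj[s's _].
  have s0 : s' != [::].
    by have [+ _ _] := As; rewrite -!size_eq0 -(size_map Pr s) -s's size_map.
  exists h; rewrite (@jordan_chain_proj_inj z s s')//.
  exact: jordan_chain_rcons As'.
by move=> [h /jordan_chain_proj]; rewrite map_rcons => Bh; apply: maxs; exists (Pr h).
Qed.

End BoundaryEigenvalueProblem.

(** * Assembly of the spectral equivalence *)

Theorem theorem6p5 (R : realType) (H Ht : completeNormedModType R[i])
    (ip : {hermitian H for false & Num.conj})
    (ipt : {hermitian Ht for false & Num.conj})
    (iota : {linear H -> Ht})
    (S : set (H * H)) (d : nat)
    (b : H * H -> 'cV[R[i]]_(2 * d)) (Q : 'M[R[i]]_(2 * d))
    (P : 'M[{poly R[i]}]_(d, 2 * d)) (A : set (Ht * Ht)) :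
  krein ip -> krein ipt ->
  (0 < d)%N ->
  closed S -> symmetric_rel ip S -> equal_defect ip S d ->
  boundary_mapping ip S b -> gram_matrix ip S b Q ->
  class_P Q P ->
  class_A ip ipt iota S A ->
  (forall z : R[i], shtraus ipt iota A z = bep_rel ip S b P (Some z)) ->
  [/\ bep_sp_p ip S b P = sp_p A,
      forall z : option R[i],
        set_bij (jordan_chain A z) (bep_jordan_chain ip S b P z)
          (map (orth_proj ipt iota)) /\
        (forall s, jordan_chain A z s ->
           (maximal_chain (jordan_chain A z) s <->
            maximal_chain (bep_jordan_chain ip S b P z)
              (map (orth_proj ipt iota) s)))
    & sp_p A = conj_set (sp_p A) ->
      [/\ spectrally_equivalent ip S b P A,
          bep_res ip S b P = res A /\
          (forall z : option R[i], bep_res ip S b P z -> forall h f : H,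
             bep_solution ip S b P z h f <->
             f = orth_proj ipt iota
                   (match z with
                    | Some l => rel_app (rel_inv (rel_shift A l)) (iota h)
                    | None => rel_app A (iota h)
                    end)),
          bep_sp_c ip S b P = sp_c A
        & [/\ setT = bep_res ip S b P `|` bep_sp_c ip S b P `|` bep_sp_p ip S b P,
              bep_res ip S b P `&` bep_sp_c ip S b P = set0,
              bep_res ip S b P `&` bep_sp_p ip S b P = set0,
              bep_sp_c ip S b P `&` bep_sp_p ip S b P = set0
            & bep_sp_r ip S b P = set0]]].

Proof.
move=> kH kHt _ _ _ _ bP _ [_ Prank Pinf _].
move=> [sA kS SA [n [e [eH e_span e_lin]]] [hatop hatnul]] shP.
have {}e_span x : orth_compl ipt iota x -> exists c : 'I_n -> R[i], x = \sum_i c i *: e i.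
  by move=> /e_span[c /subr0_eq xc]; exists c.
have {e_lin}e_free (c : 'I_n -> R[i]) : \sum_i c i *: e i = 0 -> forall i, c i = 0.
  exact: e_lin.
(* The condition on eigenvalues covers finite [z]; being an operator covers infinity. *)
have hat_nul z x : orth_compl ipt iota x -> A (zpair z x 0) -> x = 0.
  move=> xH; case: z => [l|] Ax; last first.
    by apply: hatop; split=> //; split=> //; exact: (orth_compl_lin _ _).1.
  have : rel_nul (rel_shift (A `&` (orth_compl ipt iota `*` orth_compl ipt iota)) l) x.
    rewrite rel_shiftE; split=> //; split=> //=; rewrite addr0.
    exact: lin_subspaceZ (orth_compl_lin _ _) _ _ xH.
  by rewrite hatnul.
have rankP z : \rank (mxpoly_ext P z) = d by case: z.
have bij z : set_bij (jordan_chain A z) (bep_jordan_chain ip S b P z)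
    (map (orth_proj ipt iota)).
  exact: (jordan_chain_bij kH kHt kS sA SA bP hat_nul rankP shP eH e_span e_free).
have sp_pE := bep_sp_pE kH kHt kS sA SA bP hat_nul rankP shP eH e_span e_free.
split=> //.
  move=> z; split=> // s As.
  exact: (maximal_chain_proj kH kHt kS sA SA bP hat_nul rankP shP eH e_span e_free).
move=> symA.
have resE : bep_res ip S b P = res A.
  apply/seteqP; split=> z /=.
    move=> /(bep_resP kH kHt kS sA SA bP hat_nul rankP shP eH e_span e_free symA).
    by move=> /(resP kHt sA symA).
  move=> /(resP kHt sA symA).
  by move=> /(bep_resP kH kHt kS sA SA bP hat_nul rankP shP eH e_span e_free symA).
have spcE : bep_sp_c ip S b P = sp_c A.
  apply/seteqP; split=> z /=.
    move=> /(bep_sp_cP kH kHt kS sA SA bP hat_nul rankP shP eH e_span e_free symA).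
    by move=> /(sp_cP kHt sA symA).
  move=> /(sp_cP kHt sA symA).
  by move=> /(bep_sp_cP kH kHt kS sA SA bP hat_nul rankP shP eH e_span e_free symA).
have bep_sprE : bep_sp_r ip S b P = set0.
  rewrite -subset0 => z.
  exact: (bep_sp_rP kH kHt kS sA SA bP hat_nul rankP shP eH e_span e_free symA).
have sprE : sp_r A = set0 by rewrite -subset0 => z; exact: (sp_rP kHt sA symA).
split=> //.
- split=> //; first by rewrite sprE.
  by move=> z _; exists (map (orth_proj ipt iota)); split=> // s _; rewrite size_map.
- split=> // z zr h f.
  exact: (bep_solutionP kH kHt kS sA SA bP hat_nul rankP shP eH e_span e_free symA).
rewrite resE spcE sp_pE; split=> //.
- apply/seteqP; split=> // z _.
  have [nz|nz] := pselect (sp_p A z); first by right.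
  left; have [rT|rT] := pselect (zrange A z = setT).
    by left; apply/(resP kHt sA symA).
  by right; apply/(sp_cP kHt sA symA).
- rewrite -subset0 => z [/(resP kHt sA symA)[_ rT]].
  by move=> /(sp_cP kHt sA symA)[_]; apply.
- by rewrite -subset0 => z [/(resP kHt sA symA)[nz _]] /nz.
- by rewrite -subset0 => z [/(sp_cP kHt sA symA)[nz _]] /nz.
Qed.
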